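(* For any finite set $X$ endowed with a set of partial bijections $\tilde A$ and every positive integer $n$ there exists a finite $A$-generated group $G=F/N$ such that for every choice of elements $g_1,\dots,g_n\in G$ there exist $f_1,\dots,f_n\in F$ such that $g_i=f_iN$ for all $i$ and the set of pairs \[\{(xg_i,xf_i)\colon x\in X,\ i=1,\dots,n\}\] is a partial function $X_{\mathcal{P}}G\to X_{\mathcal{P}}F$. In particular, this set of pairs is a partial bijection whose inverse is induced by the canonical mapping $X_{\mathcal{P}}F\twoheadrightarrow X_{\mathcal{P}}G$.
   Context: $\tilde A=A\cup A^{-1}$ is a set of partial bijections of $X$ closed under inversion, acting on the right, $x\mapsto x\cdot a$. The elements of $A$ also serve as abstract symbols, in which case $A^{-1}$ is a disjoint set of formal inverses. $\mathcal{P}$ is the $A$-labelled graph with vertex set $X$ and an edge $x_1\to x_2$ labelled $a\in\tilde A$ whenever $x_1\cdot a=x_2$. An $A$-generated group is a group $G$ with a map $A\to G$ (not necessarily injective) whose image generates $G$; $[a]_G$ is the value of $a\in\tilde A$. $F$ is the free group on $A$; $G=F/N$ with $N$ a normal subgroup of $F$, as an $A$-generated group via $a\mapsto aN$. For an $A$-generated group $G$ let $\Theta(\mathcal{P})$ be the smallest equivalence relation on $X\times G$ that is compatible with all operations $(x,g)\mapsto(x,g[a]_G)$, $a\in\tilde A$, and contains all pairs $((x_1,[a]_G),(x_2,1_G))$ with $a\in\tilde A$ and $x_1\cdot a=x_2$. Then $X_{\mathcal{P}}G=(X\times G)/\Theta(\mathcal{P})$, and $xg$ denotes the class of $(x,g)$.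 The canonical mapping $X_{\mathcal{P}}F\twoheadrightarrow X_{\mathcal{P}}G$ is $xf\mapsto x(fN)$. A set of pairs is a partial function if pairs with equal first entries have equal second entries. *)

(* Defs.v *)
From HB Require Import structures.
From mathcomp Require Import all_boot.
From mathcomp Require Import boolp classical_sets cardinality.

Set Implicit Arguments.
Unset Strict Implicit.
Unset Printing Implicit Defensive.

Import Algebra.
Local Open Scope group_scope.
Local Open Scope quotient_scope.

Section PartialBijections.
Variable X : finType.

Definition pinjective (f : {ffun X -> option X}) : bool :=
  [forall x, forall y, (f x == f y) ==> f x ==> (x == y)].

Definition pbij := {f : {ffun X -> option X} | pinjective f}.

Definition pbij_fun (f : pbij) : X -> option X := val f.

Definition pinv_fun (f : pbij) : {ffun X -> option X} :=
  [ffun y => [pick x | pbij_fun f x == Some y]].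

Lemma pinv_funP (f : pbij) x y :
  (pinv_fun f y == Some x) = (pbij_fun f x == Some y).
Proof.
rewrite ffunE; case: pickP => [z /eqP fz|nof]; last first.
  by rewrite nof; apply/eqP.
apply/eqP/eqP => [[<-] //|fx]; congr Some; apply/eqP.
have /forallP/(_ z)/forallP/(_ x) := valP f.
by rewrite -!/(pbij_fun f _) fz fx eqxx.
Qed.

Lemma pinv_subproof (f : pbij) : pinjective (pinv_fun f).
Proof.
apply/forallP => y; apply/forallP => z; apply/implyP => /eqP yz; apply/implyP.
case E: (pinv_fun f y) => [x|//] _.
have: pinv_fun f y == Some x by rewrite E.
have: pinv_fun f z == Some x by rewrite -yz E.
by rewrite !pinv_funP => /eqP -> /eqP [->].
Qed.

Definition pinv (f : pbij) : pbij := Sub (pinv_fun f) (pinv_subproof f).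

End PartialBijections.

(* [(a, false)] stands for [a], [(a, true)] for its formal inverse. *)
Definition letter (L : Type) : Type := (L * bool)%type.

Definition linv (L : Type) (l : letter L) : letter L := (l.1, ~~ l.2).

Lemma linvK (L : Type) : involutive (@linv L).
Proof. by case=> a b; rewrite /linv /= negbK. Qed.

(* The free group on [L], realised by reduced words. *)
Section FreeGroup.
Variable L : choiceType.

Implicit Types (l m : letter L) (u v w : seq (letter L)).

Definition reduced w : bool := sorted (fun l m => m != linv l) w.

Definition push l w :=
  if w is m :: w' then if m == linv l then w' else l :: w else [:: l].

(* The reduced form of the concatenation [u ++ v], for reduced [v]. *)
Definition wmul u v := foldr push v u.

Lemma push_reduced l w : reduced w -> reduced (push l w).
Proof.
case: w => [//|m w] /=; case: eqP => [_ /path_sorted //|/eqP ne rw].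
by rewrite /= ne.
Qed.

Lemma pushK l w : reduced w -> push (linv l) (push l w) = w.
Proof.
case: w => [|m w] rw /=; first by rewrite linvK eqxx.
case: eqP rw => [->|_] rw /=; last by rewrite linvK eqxx.
case: w rw => [|p w] //= /andP[/negPf + _].
by move=> ->.
Qed.

Lemma wmul_reduced u v : reduced v -> reduced (wmul u v).
Proof. by move=> rv; elim: u => //= l u; apply: push_reduced. Qed.

Lemma wmulw0 u : reduced u -> wmul u [::] = u.
Proof.
elim: u => //= l [//|m u] IH /= /andP[ne /IH /= ->] /=.
by rewrite (negPf ne).
Qed.

Lemma wmul_push l u w : reduced u -> reduced w ->
  wmul (push l u) w = push l (wmul u w).
Proof.
move=> ru rw; case: u ru => [//|m u] ru /=; case: eqP => [->|//].
by rewrite -{1}[l]linvK pushK // wmul_reduced.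
Qed.

Lemma wmulA u v w : reduced u -> reduced v -> reduced w ->
  wmul u (wmul v w) = wmul (wmul u v) w.
Proof.
move=> ru rv rw; elim: u ru => //= l u IH /path_sorted ru.
by rewrite IH // wmul_push // wmul_reduced.
Qed.

Definition winv w := rev (map (@linv L) w).

Lemma winv_reduced w : reduced w -> reduced (winv w).
Proof.
rewrite /reduced /winv rev_sorted sorted_map; apply: sub_sorted => l m /=.
by rewrite linvK; apply: contra => /eqP ->.
Qed.

Lemma winvK : involutive winv.
Proof.
by move=> w; rewrite /winv map_rev revK -map_comp map_id_in // => l _ /=;
  rewrite linvK.
Qed.

Lemma wmulVw w : reduced w -> wmul (winv w) w = [::].
Proof.
have H v u : reduced u -> wmul (winv v) (wmul v u) = u.
  elim: v u => [//|l v IH] u ru /=.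
  rewrite /winv map_cons rev_cons /wmul foldr_rcons.
  rewrite pushK -/(wmul _ _); last exact: wmul_reduced.
  exact: IH.
by move=> rw; rewrite -{2}(wmulw0 rw) H.
Qed.

Definition free_group := {w : seq (letter L) | reduced w}.

HB.instance Definition _ := Choice.on free_group.

Definition fg_one : free_group := Sub [::] isT.

Definition fg_mul (f g : free_group) : free_group :=
  Sub (wmul (val f) (val g)) (wmul_reduced (val f) (valP g)).

Definition fg_inv (f : free_group) : free_group :=
  Sub (winv (val f)) (winv_reduced (valP f)).

Lemma fg_mulA : associative fg_mul.
Proof. by move=> f g h; apply/val_inj; rewrite /= wmulA ?(valP _). Qed.

Lemma fg_mul1 : left_id fg_one fg_mul.
Proof. by move=> f; apply/val_inj. Qed.

Lemma fg_1mul : right_id fg_one fg_mul.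
Proof. by move=> f; apply/val_inj; rewrite /= wmulw0 // (valP f). Qed.

Lemma fg_mulV : left_inverse fg_one fg_inv fg_mul.
Proof. by move=> f; apply/val_inj; rewrite /= wmulVw // (valP f). Qed.

Lemma fg_Vmul : right_inverse fg_one fg_inv fg_mul.
Proof.
move=> f; apply/val_inj; rewrite /= -{1}[val f]winvK wmulVw //.
exact: winv_reduced (valP f).
Qed.

HB.instance Definition _ :=
  isGroup.Build free_group fg_mulA fg_mul1 fg_1mul fg_mulV fg_Vmul.

Definition fg_gen (a : L) : free_group := Sub [:: (a, false)] isT.

End FreeGroup.

(* [group_closed] predicates are the subgroups of [G], so [agenP] says that the
   subgroup generated by the values [agen a] is the whole group. *)
Record agroup (L : Type) := AGroup {
  agroup_sort :> groupType;
  agen : L -> agroup_sort;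
  agenP : forall S : {pred agroup_sort},
    group_closed S -> (forall a, agen a \in S) -> forall g, g \in S
}.

Definition lval (L : Type) (G : agroup L) (l : letter L) : G :=
  if l.2 then (agen G l.1)^-1 else agen G l.1.

Section FreeAGroup.
Variable L : choiceType.

Lemma fg_consE (l : letter L) (w : seq (letter L)) (rw : reduced (l :: w)) :
  Sub (l :: w) rw = (if l.2 then (fg_gen l.1)^-1 else fg_gen l.1)
     * Sub w (path_sorted rw) :> free_group L.
Proof.
have pushE : push l w = l :: w.
  by case: w rw => //= m w /andP[/negPf -> _].
by apply/val_inj; case: l rw pushE => a [] rw /= <-.
Qed.

Lemma fg_genP (S : {pred free_group L}) :
  group_closed S -> (forall a, fg_gen a \in S) -> forall g, g \in S.
Proof.
move=> gS genS [w]; elim: w => [|l w IH] rw.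
  have -> : exist (fun w => reduced w) [::] rw = 1 :> free_group L.
    exact/val_inj.
  by case: gS.
rewrite -[exist _ _ _]/(Sub (l :: w) rw : free_group L) fg_consE.
apply: group_closedM => //; last exact: IH.
by case: l.2 => //; apply: group_closedV.
Qed.

Definition freeG : agroup L := AGroup fg_genP.

Lemma fg_universal (H : groupType) (h : L -> H) :
  exists2 phi : {multiplicative free_group L -> H},
    forall a, phi (fg_gen a) = h a &
    forall psi : {multiplicative free_group L -> H},
      (forall a, psi (fg_gen a) = h a) -> psi =1 phi.
Proof.
pose hl (l : letter L) := if l.2 then (h l.1)^-1 else h l.1.
pose ev (w : seq (letter L)) := \prod_(l <- w) hl l.
have hlV l : hl (linv l) = (hl l)^-1.
  by case: l => a [] //=; rewrite /hl /= invgK.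
have ev_push l w : ev (push l w) = hl l * ev w.
  case: w => [|m w] /=; first by rewrite /ev big_seq1 big_nil mulg1.
  rewrite /ev; case: eqP => [->|_]; rewrite ?big_cons //.
  by rewrite hlV mulgA mulgV mul1g.
have evM : {morph (fun f : free_group L => ev (val f)) : f g / f * g}.
  move=> f g /=; elim: (val f) => [|l w IH] /=.
    by rewrite /ev big_nil mul1g.
  by rewrite ev_push IH mulgA; congr (_ * _); rewrite /ev big_cons.
pose phiM := isMultiplicative.Build _ _ (fun f : free_group L => ev (val f)) evM.
pose phi : {multiplicative free_group L -> H} :=
  Multiplicative.Pack (Multiplicative.Class phiM).
have phi_gen a : phi (fg_gen a) = h a by rewrite /= /ev big_seq1.
exists phi => // psi psi_gen.
have m1 (chi : {multiplicative free_group L -> H}) : chi 1 = 1.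
  by apply: (mulgI (chi 1)); rewrite -gmulfM !mulg1.
have mV (chi : {multiplicative free_group L -> H}) x : chi x^-1 = (chi x)^-1.
  by apply: (mulgI (chi x)); rewrite -gmulfM !mulgV m1.
move=> f; apply/eqP; move: f.
apply: (@fg_genP (fun f => psi f == phi f)) => [|a]; last first.
  by rewrite unfold_in phi_gen psi_gen.
split=> [|x y]; rewrite !unfold_in ?m1 // => /eqP e1 /eqP e2.
by rewrite !gmulfM !mV e1 e2.
Qed.

End FreeAGroup.

(* Under the classical axioms every subset of [G] is a boolean predicate. *)
Record normal_subgroup (G : groupType) := NormalSubgroup {
  nsg_pred :> {pred G};
  nsg_closed : group_closed nsg_pred;
  nsg_conj : forall x y, x \in nsg_pred -> x ^ y \in nsg_pred
}.

Section Quotient.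
Variables (G : groupType) (N : normal_subgroup G).

Definition coset_rel : rel G := fun x y => x^-1 * y \in nsg_pred N.

Lemma coset_rel_refl : reflexive coset_rel.
Proof. by move=> x; rewrite /coset_rel mulVg; case: (nsg_closed N). Qed.

Lemma coset_rel_sym : symmetric coset_rel.
Proof.
have H x y : coset_rel x y -> coset_rel y x.
  by move=> /(group_closedV (nsg_closed N)); rewrite invgM invgK.
by move=> x y; apply/idP/idP; apply: H.
Qed.

Lemma coset_rel_trans : transitive coset_rel.
Proof.
move=> y x z xy yz; move: (group_closedM (nsg_closed N) xy yz).
by rewrite mulgA mulgK.
Qed.

Definition coset_equiv := EquivRel coset_rel
  coset_rel_refl coset_rel_sym coset_rel_trans.

Definition quotient_group := {eq_quot coset_equiv}.

HB.instance Definition _ := Choice.on quotient_group.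
HB.instance Definition _ := EqQuotient.on quotient_group.

Definition coset (x : G) : quotient_group := \pi_quotient_group x.

Lemma cosetP x y : (coset x = coset y) <-> (x^-1 * y \in nsg_pred N).
Proof. by split=> [/eqP|?]; last apply/eqP; rewrite eqmodE. Qed.

Lemma coset_surj (q : quotient_group) : exists x, q = coset x.
Proof. by exists (repr q); rewrite /coset reprK. Qed.

Definition quot_mul (p q : quotient_group) : quotient_group :=
  coset (repr p * repr q).

Definition quot_inv (p : quotient_group) : quotient_group :=
  coset (repr p)^-1.

Lemma repr_coset x : (repr (coset x))^-1 * x \in nsg_pred N.
Proof. by apply/cosetP; rewrite /coset reprK. Qed.

Lemma quot_mulE x y : quot_mul (coset x) (coset y) = coset (x * y).
Proof.
apply/cosetP; set a := repr _; set b := repr _.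
have -> : (a * b)^-1 * (x * y) = (a^-1 * x) ^ b * (b^-1 * y).
  by rewrite /conjg invgM !mulgA mulgK.
apply: group_closedM; [exact: nsg_closed| |exact: repr_coset].
exact/nsg_conj/repr_coset.
Qed.

Lemma quot_invE x : quot_inv (coset x) = coset x^-1.
Proof.
apply/cosetP; set a := repr _; rewrite invgK.
have -> : a * x^-1 = ((a^-1 * x) ^ a^-1)^-1.
  by rewrite /conjg !invgM !invgK !mulgA mulgK.
apply: group_closedV; first exact: nsg_closed.
exact/nsg_conj/repr_coset.
Qed.

Lemma quot_mulA : associative quot_mul.
Proof.
move=> p q r; have [x ->] := coset_surj p; have [y ->] := coset_surj q.
by have [z ->] := coset_surj r; rewrite !quot_mulE mulgA.
Qed.

Lemma quot_mul1 : left_id (coset 1) quot_mul.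
Proof. by move=> p; have [x ->] := coset_surj p; rewrite quot_mulE mul1g. Qed.

Lemma quot_1mul : right_id (coset 1) quot_mul.
Proof. by move=> p; have [x ->] := coset_surj p; rewrite quot_mulE mulg1. Qed.

Lemma quot_mulV : left_inverse (coset 1) quot_inv quot_mul.
Proof.
by move=> p; have [x ->] := coset_surj p; rewrite quot_invE quot_mulE mulVg.
Qed.

Lemma quot_Vmul : right_inverse (coset 1) quot_inv quot_mul.
Proof.
by move=> p; have [x ->] := coset_surj p; rewrite quot_invE quot_mulE mulgV.
Qed.

HB.instance Definition _ := isGroup.Build quotient_group
  quot_mulA quot_mul1 quot_1mul quot_mulV quot_Vmul.

Lemma cosetM : {morph coset : x y / x * y}.
Proof. by move=> x y; rewrite -quot_mulE. Qed.

Lemma coset1 : coset 1 = 1.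
Proof. by []. Qed.

Lemma cosetV x : coset x^-1 = (coset x)^-1.
Proof. by rewrite -quot_invE. Qed.

End Quotient.

Section QuotientAGroup.
Variables (L : Type) (G : agroup L) (N : normal_subgroup G).

Lemma quot_genP (S : {pred quotient_group N}) :
  group_closed S -> (forall a, coset N (agen G a) \in S) -> forall g, g \in S.
Proof.
move=> [S1 SF] genS g; have [x ->] := coset_surj g.
apply: (@agenP _ G [pred x | coset N x \in S]) => // {x}.
split=> [|x y]; rewrite !inE ?coset1 // cosetM cosetV; exact: SF.
Qed.

Definition quotG : agroup L := AGroup quot_genP.

End QuotientAGroup.

Section Graph.
Variables (X : finType) (A : {set pbij X}).

(* The members of [A] as abstract symbols: [a] and a formal inverse [b^-1] stay
   distinct even when they are the same partial bijection. *)
Definition label := {a : pbij X | a \in A}.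

Definition pact (x : X) (l : letter label) : option X :=
  pbij_fun (if l.2 then pinv (val l.1) else val l.1) x.

Definition edge (l : letter label) (x1 x2 : X) : bool := pact x1 l == Some x2.

Section Theta.
Variable G : agroup label.

Inductive Theta : X * G -> X * G -> Prop :=
| Theta_edge l x1 x2 : edge l x1 x2 -> Theta (x1, lval G l) (x2, 1)
| Theta_op l p q : Theta p q ->
    Theta (p.1, p.2 * lval G l) (q.1, q.2 * lval G l)
| Theta_refl p : Theta p p
| Theta_sym p q : Theta p q -> Theta q p
| Theta_trans p q r : Theta p q -> Theta q r -> Theta p r.

Definition theta : rel (X * G) := fun p q => `[< Theta p q >].

Lemma theta_refl : reflexive theta.
Proof. by move=> p; apply/asboolP; apply: Theta_refl. Qed.

Lemma theta_sym : symmetric theta.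
Proof. by move=> p q; apply/asboolP/asboolP; apply: Theta_sym. Qed.

Lemma theta_trans : transitive theta.
Proof.
by move=> q p r /asboolP pq /asboolP qr; apply/asboolP/(Theta_trans pq).
Qed.

Definition theta_equiv := EquivRel theta theta_refl theta_sym theta_trans.

Definition XP := {eq_quot theta_equiv}.

Definition xcls (x : X) (g : G) : XP := \pi_XP (x, g).

Lemma xclsP x g y h : xcls x g = xcls y h <-> Theta (x, g) (y, h).
Proof.
split=> [/eqP|t]; last apply/eqP; rewrite eqmodE /=; first by move/asboolP.
exact/asboolP.
Qed.

End Theta.

Section CanonicalMap.
Variable N : normal_subgroup (freeG label).

Definition can_map : XP (freeG label) -> XP (quotG N) :=
  lift_fun1 (XP (freeG label)) (fun p => xcls (G := quotG N) p.1 (coset N p.2)).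

Lemma can_mapE x f :
  can_map (xcls x f) = xcls (G := quotG N) x (coset N f).
Proof.
rewrite /can_map -lock; apply/xclsP.
have lvalE l : coset N (lval (freeG label) l) = lval (quotG N) l.
  by rewrite /lval; case: l.2; rewrite ?cosetV.
have H p q : Theta p q ->
    Theta (G := quotG N) (p.1, coset N p.2) (q.1, coset N q.2).
  elim=> {p q} [l x1 x2 e|l p q _ IH|p|p q _ IH|p q r _ IH1 _ IH2] /=.
  - by rewrite lvalE coset1; apply: Theta_edge.
  - by rewrite !cosetM lvalE; apply: (Theta_op l IH).
  - exact: Theta_refl.
  - exact: Theta_sym.
  - exact: Theta_trans IH1 IH2.
apply: (H _ (x, f)); case E: (repr _) => [y h] /=.
by apply/xclsP; rewrite /xcls -E reprK.
Qed.

End CanonicalMap.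

End Graph.

Section Pairs.
Local Open Scope classical_set_scope.

Definition partial_function (U V : Type) (P : set (U * V)) : Prop :=
  forall u v v', P (u, v) -> P (u, v') -> v = v'.

Definition converse (U V : Type) (P : set (U * V)) : set (V * U) :=
  [set q | P (q.2, q.1)].

Definition partial_bijection (U V : Type) (P : set (U * V)) : Prop :=
  partial_function P /\ partial_function (converse P).

(* The partial function [R] from [V] to [U] is a restriction of [c]. *)
Definition induced_by (U V : Type) (R : set (V * U)) (c : V -> U) : Prop :=
  forall v u, R (v, u) -> c v = u.

Definition pairs (X : finType) (A : {set pbij X})
    (N : normal_subgroup (freeG (label A))) (n : nat)
    (g : 'I_n -> quotG N) (f : 'I_n -> freeG (label A)) :
    set (XP (quotG N) * XP (freeG (label A))) :=
  [set (xcls x (g i), xcls x (f i)) | x in [set: X] & i in [set: 'I_n]].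

End Pairs.

(* Main.v *)
(* Work first with words over a finite alphabet of involutions.  For a bound [b]
   on orbit sizes call a word over [d] a relator if it acts trivially on every
   orbit with at most [b d] points on which the relators over the proper subsets
   of [d] already act trivially.  Relators over [d] cut out a finite group K[d],
   and K[d'] embeds in K[d] for d' included in d.  The slack is that an orbit of
   at most [b d] points may be glued from cosets of smaller groups K[d'].  If [b]
   grows fast enough, K therefore acts on glueings which show that

   - if the label of a path in a graph of at most [B0] vertices is congruent to a
     word over [d], it is congruent to the label of a path that uses only [d]
     ([path_reducesP]);
   - if a closed chain of at most [R] cosets K[d_i] is not degenerate at an
     interior link, the first coset K[d_1] is cut by its two neighbours
     ([chain_split], [word_cycle]).

   For the theorem the alphabet consists of the edges of a finite graph of states
   on which the partial bijections act by permutations, and G consists of the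
   words modulo those that read as relators in this graph.  The subsets X g of
   X_P G become components of subgraphs of the Cayley graph.  Given g_1,..,g_n,
   connect them by a network of relations of least weight, the weight 3^|d| of an
   edge being steep enough that an edge is never worth two shorter ones.  By the
   facts above, a relation between two g_i that does not follow from edges with
   smaller label would cut some edge into two shorter pieces.  So a network of
   least weight is a forest that implies all the relations, and a forest lifts to
   the free group edge by edge. *)
Require Import Defs.
From HB Require Import structures.
From mathcomp Require Import all_boot fingroup perm.
From mathcomp Require Import boolp.

Set Implicit Arguments.
Unset Strict Implicit.
Unset Printing Implicit Defensive.

(** * Words in involutions *)

Section Words.
Variable E : finType.
Implicit Types (d g : {set E}) (u v w : seq E) (e : E).

Definition over d w : bool := all (fun e => e \in d) w.

Lemma over_cat d u v : over d (u ++ v) = over d u && over d v.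
Proof. exact: all_cat. Qed.

Lemma over_rev d w : over d (rev w) = over d w.
Proof. exact: all_rev. Qed.

Lemma over_sub d g w : d \subset g -> over d w -> over g w.
Proof. by move=> /subsetP dg; apply: sub_all. Qed.

Lemma overT w : over setT w.
Proof. by apply/allP => e _; rewrite inE. Qed.

Lemma overI d g w : over (d :&: g) w = over d w && over g w.
Proof. by rewrite /over -all_predI; apply: eq_all => e; rewrite /= inE. Qed.

Lemma over0 w : over set0 w -> w = [::].
Proof. by case: w => //= e w; rewrite inE. Qed.

Definition restr g w := filter (fun e => e \in g) w.

Lemma over_restr d g w : over d w -> over (d :&: g) (restr g w).
Proof.
move=> /allP ow; apply/allP => e; rewrite mem_filter inE => /andP[-> /ow ->].
by [].
Qed.

Lemma over_restr_id g w : over g w -> restr g w = w.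
Proof. by move=> ow; apply/all_filterP. Qed.

Lemma restr_cat g u v : restr g (u ++ v) = restr g u ++ restr g v.
Proof. exact: filter_cat. Qed.

Lemma restr_rev g w : restr g (rev w) = rev (restr g w).
Proof. exact: filter_rev. Qed.

(** Points are compared by [eeq] because the glued spaces below are quotients of sets of words. By
    [estepK] a reversed word undoes the word. *)
Record eact := EAct {
  ecar :> Type;
  eeq : ecar -> ecar -> Prop;
  estep : E -> ecar -> ecar;
  eeq_refl : forall x, eeq x x;
  eeq_sym : forall x y, eeq x y -> eeq y x;
  eeq_trans : forall x y z, eeq x y -> eeq y z -> eeq x z;
  estep_proper : forall e x y, eeq x y -> eeq (estep e x) (estep e y);
  estepK : forall e x, eeq (estep e (estep e x)) x
}.

Definition erun (S : eact) (x : S) w : S := foldl (fun y e => estep e y) x w.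

Section Runs.
Variable S : eact.
Implicit Types x y z : S.

Lemma erun_cat x u v : erun x (u ++ v) = erun (erun x u) v.
Proof. exact: foldl_cat. Qed.

Lemma erun_rcons x u e : erun x (rcons u e) = estep e (erun x u).
Proof. by rewrite -cats1 erun_cat. Qed.

Lemma erun_proper w x y : eeq x y -> eeq (erun x w) (erun y w).
Proof. by elim: w x y => //= e w IH x y xy; apply/IH/estep_proper. Qed.

Lemma erunK x w : eeq (erun (erun x w) (rev w)) x.
Proof.
elim: w x => [|e w IH] x /=; first exact: eeq_refl.
rewrite rev_cons erun_rcons; apply: eeq_trans (estepK e x).
exact/estep_proper/IH.
Qed.

Lemma erunVK x w : eeq (erun (erun x (rev w)) w) x.
Proof. by have := erunK x (rev w); rewrite revK. Qed.

Definition covered d x n :=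
  exists f : 'I_n -> S, forall u, over d u -> exists i, eeq (erun x u) (f i).

Lemma covered_fin (I : finType) d x n (f : I -> S) :
  #|I| <= n ->
  (forall u, over d u -> exists i, eeq (erun x u) (f i)) -> covered d x n.
Proof.
move=> cI cf.
exists (fun j => if insub (val j) is Some k then f (enum_val (k : 'I_#|I|)) else x).
move=> u /cf [i xi]; exists (widen_ord cI (enum_rank i)) => /=.
by rewrite valK enum_rankK.
Qed.

Lemma covered_le d x m n : m <= n -> covered d x m -> covered d x n.
Proof. by move=> mn [f cf]; apply: covered_fin cf; rewrite card_ord. Qed.

Lemma covered_run d x u n : over d u -> covered d x n -> covered d (erun x u) n.
Proof.
move=> ou [f cf]; exists f => v ov; rewrite -erun_cat.
by apply: cf; rewrite over_cat ou.
Qed.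

End Runs.

(** * Relators over a set of letters *)

Section Trivial.
Variable b : {set E} -> nat.

(* The fuel [k] only serves the recursion on proper subsets: any [k > #|d|] gives
   the same predicate, see [trk_fuel]. *)
Fixpoint trk k d w : Prop :=
  if k is k'.+1 then
    forall (S : eact) (x : S), covered d x (b d) ->
      (forall d' w', d' \proper d -> over d' w' -> trk k' d' w' ->
         forall u, over d u -> eeq (erun (erun x u) w') (erun x u)) ->
      eeq (erun x w) x
  else True.

Definition tr d w := trk #|d|.+1 d w.

Lemma trk_fuel k k' d w : #|d| < k -> #|d| < k' -> trk k d w -> trk k' d w.
Proof.
elim: k k' d w => [|k IH] [|k'] d w //= dk dk' H S x cx kx.
apply: H cx _ => d' w' dd' ow' tw' u ou; apply: (kx d') => //.
by apply: IH tw'; apply: leq_trans (proper_card dd') _.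
Qed.

Definition killed (S : eact) d (x : S) := forall d' w',
  d' \proper d -> over d' w' -> tr d' w' ->
  forall u, over d u -> eeq (erun (erun x u) w') (erun x u).

Lemma trP d w : tr d w <->
  forall (S : eact) (x : S), covered d x (b d) -> killed d x -> eeq (erun x w) x.
Proof.
split=> H S x cx kx.
  apply: H cx _ => d' w' dd' ow' tw'; apply: (kx d') => //.
  by apply: trk_fuel tw' => //; apply: proper_card.
apply: H cx _ => d' w' dd' ow' tw'; apply: (kx d') => //.
by apply: trk_fuel tw' => //; apply: proper_card.
Qed.

Lemma killed_run (S : eact) d (x : S) u : over d u -> killed d x -> killed d (erun x u).
Proof.
move=> ou kx d' w' dd' ow' tw' v ov; rewrite -(erun_cat x u v).
by apply: (kx d') => //; rewrite over_cat ou.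
Qed.

Lemma tr_cat d u v : tr d u -> tr d v -> tr d (u ++ v).
Proof.
move=> /trP tu /trP tv; apply/trP => S x cx kx; rewrite erun_cat.
apply: eeq_trans (tv _ _ cx kx); exact/erun_proper/tu.
Qed.

Lemma tr_rev d u : tr d u -> tr d (rev u).
Proof.
move=> /trP tu; apply/trP => S x cx kx.
apply: eeq_trans (erunK x u); apply/erun_proper/eeq_sym; exact: tu.
Qed.

Lemma tr_conj d u w : over d u -> tr d w -> tr d (u ++ w ++ rev u).
Proof.
move=> ou /trP tw; apply/trP => S x cx kx; rewrite !erun_cat.
apply: eeq_trans (erunK x u); apply/erun_proper/tw.
  exact: covered_run.
exact: killed_run.
Qed.

Lemma tr_cancel d w : tr d (w ++ rev w).
Proof. by apply/trP => S x _ _; rewrite erun_cat; apply: erunK. Qed.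

Lemma tr_up d g w : d \subset g -> over d w -> tr d w -> tr g w.
Proof.
move=> dg ow tw; case: (eqVproper dg) => [<- //|dg'].
by apply/trP => S x _ kx; apply: (kx d w dg' ow tw [::]).
Qed.

(** By induction on [#|d|], relators over smaller sets act trivially at every point, so [killed]
    holds and only the size of the orbit remains. *)
Lemma tr_act (S : eact) :
  (forall (y : S) d, covered d y (b d) \/
     forall w, over d w -> tr d w -> eeq (erun y w) y) ->
  forall (y : S) d w, over d w -> tr d w -> eeq (erun y w) y.
Proof.
move=> H y d; move: {2}(#|d|.+1) (ltnSn #|d|) => k.
elim: k y d => // k IH y d dk w ow tw.
have [cy|] := H y d; last exact.
move/trP: tw; apply=> // d' w' dd' ow' tw' u ou.
by apply: IH tw' => //; apply: leq_trans (proper_card dd') _.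
Qed.

Hypothesis bmono : forall d g, d \subset g -> b d <= b g.

Section RestrAct.
Variables (S : eact) (g : {set E}).
Let rstep e (x : S) := if e \in g then estep e x else x.
Lemma rstep_proper e x y : eeq x y -> eeq (rstep e x) (rstep e y).
Proof. by rewrite /rstep; case: ifP => // _; apply: estep_proper. Qed.
Lemma rstepK e x : eeq (rstep e (rstep e x)) x.
Proof.
by rewrite /rstep; case: (e \in g); [apply: estepK|apply: eeq_refl].
Qed.
Definition ract := EAct (@eeq_refl S) (@eeq_sym S) (@eeq_trans S) rstep_proper rstepK.
Lemma ract_run x w : erun (S := ract) x w = erun (S := S) x (restr g w).
Proof.
by elim: w x => //= e w IH x; rewrite IH /rstep; case: ifP.
Qed.
End RestrAct.

(** An action for [d :&: g] becomes one for [d] when letters outside [g] do nothing. So deleting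
    letters retracts K[d] onto K[d :&: g], which yields the embedding [tr_down]. *)
Lemma tr_restr d g w : over d w -> tr d w -> tr (d :&: g) (restr g w).
Proof.
move: {2}(#|d|.+1) (ltnSn #|d|) => k; elim: k d w => // k IH d w dk ow tw.
apply/trP => S x cx kx; rewrite -ract_run.
apply: (iffLR (trP _ _) tw (ract S g) x).
  case: (covered_le (bmono (subsetIl d g)) cx) => f cf; exists f => u ou.
  by rewrite ract_run; apply/cf/over_restr.
move=> d' w' dd' ow' tw' u ou; rewrite !ract_run.
have ou' := over_restr g ou.
have dg' : d' :&: g \subset d :&: g by apply/setSI/proper_sub.
have tr' : tr (d' :&: g) (restr g w').
  by apply: IH => //; apply: leq_trans (proper_card dd') _.
(* If [d'] has the same trace on [g] as [d], the shortened word is a relator over [d :&: g] itself,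
   which acts trivially at the point by definition. *)
have [eq|pr] := eqVproper dg'; last by apply: (kx _ _ pr) => //; apply: over_restr.
rewrite eq in tr'; move/trP: tr'; apply; first exact: covered_run.
exact: killed_run.
Qed.

Lemma tr_down d g w : d \subset g -> over d w -> tr g w -> tr d w.
Proof.
move=> dg ow tw; have := tr_restr (g := d) (over_sub dg ow) tw.
by rewrite (setIidPr dg) over_restr_id.
Qed.

Lemma trT d w : over d w -> tr setT w <-> tr d w.
Proof. by move=> ow; split; [apply: tr_down|apply: tr_up]. Qed.

Lemma trT_restr g w : tr setT w -> tr setT (restr g w).
Proof.
move=> tw; have og : over g (restr g w) by have := over_restr g (overT w); rewrite setTI.
by apply/(trT og); have := tr_restr (g := g) (overT w) tw; rewrite setTI.
Qed.

End Trivial.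

Lemma tr_ext b b' d w : (forall d', d' \subset d -> b d' = b' d') -> tr b d w -> tr b' d w.
Proof.
move: {2}(#|d|.+1) (ltnSn #|d|) => k.
elim: k b b' d w => // k IH b b' d w dk bb' /trP tw; apply/trP => S x cx kx.
apply: tw; first by rewrite bb'.
move=> d' w' dd' ow' tw'; apply: (kx d') => //.
apply: IH tw'; first by apply: leq_trans (proper_card dd') _.
by move=> d'' dd''; apply/bb'/(subset_trans dd'')/proper_sub.
Qed.

(* Arbitrary transformations of ['I_n] are admitted, not only actions by
   involutions: they include all models of orbits with at most [n] points, and
   only the cardinality of the type matters. *)
Definition codeT n : finType :=
  {ffun {ffun E -> {ffun 'I_n -> 'I_n}} * 'I_n -> 'I_n}.

Definition code n w : codeT n :=
  [ffun a : {ffun E -> {ffun 'I_n -> 'I_n}} * 'I_n =>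
     foldl (fun i e => a.1 e i) a.2 w].

(** Numbering an orbit of at most [n] points turns the action into transformations of ['I_n], on
    which words of equal code agree. Hence K[d] is finite. *)
Lemma code_tr b d n u v : b d <= n -> over d u -> over d v ->
  code n u = code n v -> tr b d (u ++ rev v).
Proof.
move=> bn ou ov cuv; apply/trP => S x /(covered_le bn) [f cf] _.
pose idx (y : S) : option 'I_n := [pick i | `[< eeq y (f i) >]].
have idxP y i : idx y = Some i -> eeq y (f i).
  by rewrite /idx; case: pickP => // j /asboolP yj [<-].
have idx_eq y z : eeq y z -> idx y = idx z.
  move=> yz; rewrite /idx; apply: eq_pick => i.
  by apply/asboolP/asboolP => H; apply: eeq_trans H => //; apply: eeq_sym.
have idx_orb w : over d w -> idx (erun x w).
  move=> /cf [i xi]; rewrite /idx; case: pickP => // /(_ i) /asboolP.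
  by move=> /(_ xi).
(* Where a step leads to no numbered point the value is arbitrary; this does not happen on the
   orbit. *)
pose st : {ffun E -> {ffun 'I_n -> 'I_n}} :=
  [ffun e => [ffun i => odflt i (idx (estep e (f i)))]].
have x0 := idx_orb [::] isT.
case Ex: (idx x) x0 => [i0|] //= _.
have run w : over d w ->
    idx (erun x w) = Some (foldl (fun i e => st e i) i0 w).
  elim/last_ind: w => [//|w e IH]; rewrite -cats1 over_cat => /andP[ow oe].
  rewrite cats1 foldl_rcons erun_rcons.
  have := IH ow; set i := foldl _ _ _ => Hi.
  have := idx_orb (rcons w e); rewrite -cats1 over_cat ow oe cats1 erun_rcons.
  move=> /(_ isT).
  rewrite (idx_eq _ _ (estep_proper e (idxP _ _ Hi))) /st !ffunE.
  by case: (idx _).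
have: foldl (fun i e => st e i) i0 u = foldl (fun i e => st e i) i0 v.
  by have := congr1 (fun c : codeT n => c (st, i0)) cuv; rewrite !ffunE.
move=> euv; rewrite erun_cat.
have xuv : eeq (erun x u) (erun x v).
  apply: eeq_trans (idxP _ _ (run _ ou)) _; rewrite euv.
  exact/eeq_sym/idxP/run.
exact: eeq_trans (erun_proper _ xuv) (erunK _ _).
Qed.

Definition eqw b u v := tr b setT (u ++ rev v).

(** * Congruence of words modulo relators *)

Section Eqw.
Variable b : {set E} -> nat.
Local Notation "u ~~ v" := (eqw b u v) (at level 70).

Lemma eqw_refl u : u ~~ u. Proof. exact: tr_cancel. Qed.

Lemma eqw_sym u v : u ~~ v -> v ~~ u.
Proof. by move=> /tr_rev; rewrite /eqw rev_cat revK. Qed.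

Lemma trT_cancel_mid u v w : tr b setT (u ++ v ++ rev v ++ w) <-> tr b setT (u ++ w).
Proof.
have H (S : eact) (x : S) :
    eeq (erun x (u ++ v ++ rev v ++ w)) (erun x (u ++ w)).
  by rewrite !erun_cat; apply/erun_proper/erunK.
split=> /trP t; apply/trP => S x cx kx.
  exact: eeq_trans (eeq_sym (H _ _)) (t _ _ cx kx).
exact: eeq_trans (H _ _) (t _ _ cx kx).
Qed.

Lemma eqw_trans v u w : u ~~ v -> v ~~ w -> u ~~ w.
Proof.
move=> uv vw; apply/(trT_cancel_mid u (rev v) (rev w)).
by have := tr_cat uv vw; rewrite -catA revK.
Qed.

Lemma eqw_catr u v w : u ~~ v -> u ++ w ~~ v ++ w.
Proof. by rewrite /eqw rev_cat -catA => ?; apply/trT_cancel_mid. Qed.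

Lemma eqw_catl u v w : u ~~ v -> w ++ u ~~ w ++ v.
Proof.
by rewrite /eqw rev_cat => /(tr_conj (overT w)); rewrite -!catA.
Qed.

Lemma eqw_cat u u' v v' : u ~~ u' -> v ~~ v' -> u ++ v ~~ u' ++ v'.
Proof. by move=> uu vv; apply: eqw_trans (eqw_catr _ uu) (eqw_catl _ vv). Qed.

Lemma eqw_nil u : u ~~ [::] <-> tr b setT u.
Proof. by rewrite /eqw cats0. Qed.

Lemma eqwVK u : u ++ rev u ~~ [::].
Proof. by apply/eqw_nil/tr_cancel. Qed.

Lemma eqwK u : rev u ++ u ~~ [::].
Proof. by rewrite -{2}[u]revK; apply: eqwVK. Qed.

Lemma eqw_rev u v : u ~~ v -> rev u ~~ rev v.
Proof.
move=> uv; apply: (@eqw_trans (rev u ++ v ++ rev v)).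
  by rewrite -{1}[rev u]cats0; apply/eqw_catl/eqw_sym/eqwVK.
rewrite catA -[rev v in X in _ ~~ X]/([::] ++ rev v).
apply: eqw_catr; apply: eqw_trans (eqwK u); exact/eqw_catl/eqw_sym.
Qed.

Lemma eqw_divl u v w : u ++ v ~~ w <-> v ~~ rev u ++ w.
Proof.
split=> [uv|vw].
  apply: eqw_trans (eqw_catl (rev u) uv); rewrite catA.
  exact: (@eqw_catr [::]) (eqw_sym (eqwK u)).
apply: eqw_trans (eqw_catl u vw) _; rewrite catA.
exact: (@eqw_catr _ [::]) (eqwVK u).
Qed.

Lemma eqw_divr u v w : u ++ v ~~ w <-> u ~~ w ++ rev v.
Proof.
split=> [uv|uw].
  apply: eqw_trans (eqw_catr (rev v) uv); rewrite -catA -{1}[u]cats0.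
  exact/eqw_catl/eqw_sym/eqwVK.
apply: eqw_trans (eqw_catr v uw) _; rewrite -catA -{2}[w]cats0.
exact/eqw_catl/eqwK.
Qed.

Lemma eqw_cancell u v w : u ++ v ~~ u ++ w -> v ~~ w.
Proof.
move=> /eqw_divl vw; apply: eqw_trans vw _; rewrite catA.
exact: (@eqw_catr _ [::]) (eqwK u).
Qed.

Hypothesis bmono : forall d g : {set E}, d \subset g -> b d <= b g.

Lemma eqw_restr g u v : u ~~ v -> restr g u ~~ restr g v.
Proof.
by rewrite /eqw => /(trT_restr bmono g); rewrite restr_cat restr_rev.
Qed.

Lemma eqw_tr d u v : over d u -> over d v -> u ~~ v <-> tr b d (u ++ rev v).
Proof. by move=> ou ov; apply: trT => //; rewrite over_cat over_rev ou. Qed.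

Lemma eqw_code n d u v : b d <= n -> over d u -> over d v ->
  code n u = code n v -> u ~~ v.
Proof. by move=> bn ou ov /(code_tr bn ou ov) /(eqw_tr ou ov). Qed.

End Eqw.

Section BoolAct.
Variable e0 : E.
Let bstep e (x : bool) := if e == e0 then ~~ x else x.
Lemma bstep_proper e x y : x = y -> bstep e x = bstep e y.
Proof. by move=> ->. Qed.
Lemma bstepK e x : bstep e (bstep e x) = x.
Proof. by rewrite /bstep; case: (e == e0); rewrite ?negbK. Qed.
Definition bact := EAct (@erefl bool) (@esym bool) (@etrans bool) bstep_proper bstepK.
End BoolAct.

(** The letter flips an orbit of two points, which the bound admits; over the empty set there is
    only the empty word. *)
Lemma tr_letter b d e : (forall d g : {set E}, d \subset g -> b d <= b g) ->
  1 < b [set e] -> e \in d -> ~ tr b d [:: e].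
Proof.
move=> bmono b1 ed t; have oe : over [set e] [:: e] by rewrite /= inE eqxx.
have {t}: tr b [set e] [:: e] by apply: tr_down t; rewrite ?sub1set.
have cov : covered (S := bact e) [set e] true (b [set e]).
  apply: (@covered_fin (bact e) bool _ _ _ id); first by rewrite card_bool.
  by move=> u _; exists (erun (S := bact e) true u).
have kil : killed b (S := bact e) [set e] true.
  move=> d' w'; rewrite properE subset1 => /andP[/orP[] /eqP ->].
    by rewrite subxx.
  by move=> _ /over0 -> _ u _.
by move=> /trP /(_ (bact e) true cov kil); rewrite /= eqxx.
Qed.

End Words.

(** * Path labels congruent to words over a subset *)

Section Covers.
Variable E : finType.
Implicit Types (d g beta : {set E}) (w : seq E) (e : E).

(** For counting orbits: a point may carry several keys, as long as a key determines its point. *)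
Lemma covered_key (S : eact E) (I : finType) d (x : S) n (K : S -> I -> Prop) :
  #|I| <= n ->
  (forall u, over d u -> exists i, K (erun x u) i) ->
  (forall y z i, K y i -> K z i -> eeq y z) -> covered d x n.
Proof.
move=> cI Kx Keq.
pose f i := if pselect (exists y, K y i) is left H then projT1 (cid H) else x.
apply: (covered_fin (f := f)) => // u /Kx [i Ki]; exists i.
rewrite /f; case: pselect => [H|[]]; last by exists (erun x u).
by apply: Keq Ki _; case: cid.
Qed.

Variables (R B0 : nat).

Definition kappa n := #|codeT E n|.

(* The increment makes room for the orbits of [gamma] with [R] cosets attached. *)
Fixpoint bn k :=
  if k is k'.+1 then bn k' + kappa (bn k') ^ 2 * (1 + kappa (bn k')) ^ R else B0.

Definition bnd d := bn #|d|.
(* Lowering the bound outside the subsets of [beta] keeps K[beta] and makes the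
   other groups so small that the orbits they give are within [bnd]. *)
Definition bndS beta d := if d \subset beta then bn #|d| else bn #|d|.-1.

Lemma bn_mono : {homo bn : m n / m <= n}.
Proof. by apply: homo_leq => // [m n p|k]; [apply: leq_trans|apply: leq_addr]. Qed.

Lemma bn_ge k : B0 <= bn k. Proof. exact: (@bn_mono 0). Qed.

Lemma bnd_mono d g : d \subset g -> bnd d <= bnd g.
Proof. by move=> dg; apply/bn_mono/subset_leq_card. Qed.

(** In the mixed case, [d] inside [beta] and [g] not, [d] is proper in [g], which pays for the
    decrement. *)
Lemma bndS_mono beta d g : d \subset g -> bndS beta d <= bndS beta g.
Proof.
move=> dg; rewrite /bndS; have [gb|gb] := boolP (g \subset beta).
  by rewrite (subset_trans dg gb); apply/bn_mono/subset_leq_card.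
have := subset_leq_card dg; case: ifP => [db|_ cdg].
  move=> _; apply: bn_mono; rewrite -ltnS prednK ?proper_card //.
    by rewrite properE dg /=; apply: contraNN gb => /subset_trans; apply.
  by rewrite card_gt0; apply: contraNneq gb => ->; rewrite sub0set.
by apply: bn_mono; rewrite -!subn1 leq_sub2r.
Qed.

Lemma bndS_ge beta d : B0 <= bndS beta d.
Proof. by rewrite /bndS; case: ifP => _; apply: bn_ge. Qed.

(** The size allowed to non-regular orbits after [j] cosets have been attached: [kappa ^ 2] at
    first, then a factor [1 + kappa] for each coset. The predecessor occurs since a set not inside
    [beta] meets it in a smaller set. *)
Definition mu j k := kappa (bn k.-1) ^ 2 * (1 + kappa (bn k.-1)) ^ j.

Lemma mu_le j k : 0 < k -> j <= R -> mu j k <= bn k.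
Proof.
case: k => // k _ jR; apply: leq_trans (leq_addl _ _).
by apply: leq_mul => //; apply: leq_pexp2l.
Qed.

Lemma muS j k : mu j.+1 k = mu j k * (1 + kappa (bn k.-1)).
Proof. by rewrite /mu [_ ^ j.+1]expnSr mulnA. Qed.

Lemma kappa_gt0 n : 0 < kappa n.
Proof. by apply/card_gt0P; exists (code n [::]). Qed.

Lemma mu_gt0 j k : 0 < mu j k.
Proof. by rewrite /mu muln_gt0 !expn_gt0 kappa_gt0. Qed.

Lemma bnd_card d d' : #|d| = #|d'| -> bnd d = bnd d'.
Proof. by rewrite /bnd => ->. Qed.

(* A [regular] orbit may be large, but relators act trivially on it and no letter
   of [d] fixes one of its points. *)
Definition regular b (S : eact E) d (x : S) :=
  (forall u w, over d u -> over d w -> tr b d w ->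
     eeq (erun (erun x u) w) (erun x u)) /\
  (forall u e, over d u -> e \in d -> ~ eeq (estep e (erun x u)) (erun x u)).

Definition good b m (S : eact E) :=
  forall (x : S) d, covered d x (m #|d|) \/ regular b d x.

Lemma good_tr j (S : eact E) (x : S) w :
  j <= R -> good bnd (mu j) S -> tr bnd setT w -> eeq (erun x w) x.
Proof.
move=> jR gS; apply: tr_act (overT w) => {}y d.
(* The empty set is separate because [mu_le] needs positive cardinality. *)
case: (set_0Vmem d) => [-> |[e ed]].
  by right=> u /over0 -> _; apply: eeq_refl.
have [cy|[ry _]] := gS y d; last by right=> u ou tu; apply: (ry [::]).
left; apply: covered_le cy; apply: mu_le => //.
by apply/card_gt0P; exists e.
Qed.

Lemma good_eqw j (S : eact E) (x : S) u w :
  j <= R -> good bnd (mu j) S -> eqw bnd u w -> eeq (erun x u) (erun x w).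
Proof.
move=> jR gS uw; have := erun_proper w (good_tr x jR gS uw).
by rewrite erun_cat => /(eeq_trans (eeq_sym (erunVK _ _))).
Qed.

Section Paths.
Variables (V : finType) (sg : E -> V -> option V).
Hypothesis sgK : forall e v u, sg e v = Some u -> sg e u = Some v.

Fixpoint pth v w := if w is e :: w' then
  if sg e v is Some u then pth u w' else None else Some v.

Lemma pth_cat v (u w : seq E) :
  pth v (u ++ w) = if pth v u is Some x then pth x w else None.
Proof. by elim: u v => //= e u IH v; case: (sg e v). Qed.

Lemma pth_rev v w u : pth v w = Some u -> pth u (rev w) = Some v.
Proof.
elim: w v => /= [v [->] //|e w IH v]; case sv: (sg e v) => [x|//] /IH H.
by rewrite rev_cons -cats1 pth_cat H /= (sgK sv).
Qed.

Let vstep e v := odflt v (sg e v).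
Lemma vstep_proper e x y : x = y -> vstep e x = vstep e y.
Proof. by move=> ->. Qed.
Lemma vstepK e x : vstep e (vstep e x) = x.
Proof.
rewrite /vstep; case sx: (sg e x) => [y|] /=; last by rewrite sx.
by rewrite (sgK sx).
Qed.
Definition vact := EAct (@erefl V) (@esym V) (@etrans V) vstep_proper vstepK.

Lemma vact_pth v w u : pth v w = Some u -> erun (S := vact) v w = u.
Proof.
elim: w v => [v [->] //|e w IH v] /=; rewrite /vstep.
by case: (sg e v) => [x|//] /IH.
Qed.

(** The vertices form an action with small orbits, so walking back along [w'] and then along [w]
    closes up. *)
Lemma pth_eqw b v w w' u u' : (forall d, #|V| <= b d) -> eqw b w w' ->
  pth v w = Some u -> pth v w' = Some u' -> u = u'.
Proof.
move=> Vb ww /vact_pth vu vu'.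
have tk (x : vact) y : tr b setT y -> eeq (erun x y) x.
  move=> ty; apply: (tr_act (S := vact) _ x (overT y) ty) => {}x d; left.
  apply: covered_le (Vb d) _; apply: (covered_fin (S := vact) (f := id)) => // z _.
  by exists (erun x z).
have := tk u' (rev w' ++ w); rewrite erun_cat.
have rw : erun (S := vact) u' (rev w') = v by apply/vact_pth/pth_rev.
rewrite rw vu; apply.
have := eqw_trans (eqw_catl (rev w') ww) (eqwK w').
by move/eqw_nil.
Qed.

Hypothesis VB : #|V| <= B0.

Definition path_reduces g := forall v c u w,
  pth v c = Some u -> over g w -> eqw bnd c w ->
  exists c', [/\ over g c', pth v c' = Some u & eqw bnd c' w].

(** * The space glued from copies of K[beta] *)

Section Gamma.
Variables (beta : {set E}) (v0 : V).
Local Notation bS := (bndS beta).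
Local Notation "u ~~ v" := (eqw bS u v) (at level 70).
Hypothesis IHbeta : forall g, g \proper beta -> path_reduces g.

(** The bounds agree on subsets of [beta], and congruence of words over [beta] involves no other
    sets. *)
Lemma bnd_bS (u w : seq E) : over beta u -> over beta w -> eqw bnd u w <-> u ~~ w.
Proof.
have ext d : d \subset beta -> bnd d = bS d by rewrite /bndS => ->.
move=> ou ow; have m1 := bnd_mono; have m2 := @bndS_mono beta.
split=> [/(eqw_tr m1 ou ow)|/(eqw_tr m2 ou ow)] t.
  by apply/(eqw_tr m2 ou ow); apply: tr_ext t.
by apply/(eqw_tr m1 ou ow); apply: tr_ext t => d /ext.
Qed.

Definition vpath := {p : seq E | pth v0 p}.
Definition mkv (p : seq E) (vp : pth v0 p) : vpath :=
  exist (fun q : seq E => pth v0 q) p vp.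
Definition endp (p : vpath) := odflt v0 (pth v0 (sval p)).

Lemma endpE (p : vpath) : pth v0 (sval p) = Some (endp p).
Proof. by rewrite /endp; case: p => p /=; case: (pth v0 p). Qed.

(* Paths from [v0] modulo [bndS beta] form a finite graph H.  A copy of K[beta] is
   glued along each [beta]-component of H; [(p, k)] is the point reached by the
   word [k] from the point [p] of H inside the copy that contains [p].  Letters
   outside [beta] move the points of H only. *)
Definition gcar := (vpath * seq E)%type.

(** Moving the base point along a [beta]-path [c] of H changes the coordinate in the coset by the
    inverse of [c]. *)
Definition geq (x y : gcar) := exists c,
  [/\ over beta c, pth (endp x.1) c, sval x.1 ++ c ~~ sval y.1 & x.2 ~~ c ++ y.2].

Lemma vend v w w' u u' : w ~~ w' -> pth v w = Some u -> pth v w' = Some u' -> u = u'.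
Proof.
by apply: pth_eqw => d; apply: leq_trans VB _; apply: bndS_ge.
Qed.

Lemma geq_end (x y : gcar) c : pth (endp x.1) c -> sval x.1 ++ c ~~ sval y.1 ->
  pth (endp x.1) c = Some (endp y.1).
Proof.
case pc: (pth _ c) => [u|//] _ xy; congr Some; apply: vend xy _ (endpE _).
by rewrite pth_cat endpE.
Qed.

Lemma geq_refl x : geq x x.
Proof. by exists [::]; rewrite cats0; split=> //; apply: eqw_refl. Qed.

Lemma geq_sym x y : geq x y -> geq y x.
Proof.
case=> c [oc pc xy kk]; exists (rev c); split; first by rewrite over_rev.
- by rewrite (pth_rev (geq_end pc xy)).
- by apply/eqw_divr; rewrite revK; apply: eqw_sym.
- by apply/eqw_divl; apply: eqw_sym.
Qed.

Lemma geq_trans x y z : geq x y -> geq y z -> geq x z.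
Proof.
case=> c [oc pc xy kk] [c' [oc' pc' yz kk']]; exists (c ++ c'); split.
- by rewrite over_cat oc.
- by rewrite pth_cat (geq_end pc xy).
- by rewrite catA; apply: eqw_trans yz; apply: eqw_catr.
- by rewrite -catA; apply: eqw_trans kk _; apply: eqw_catl.
Qed.

Lemma geq_path (p q : vpath) k l : sval p ~~ sval q -> k ~~ l -> geq (p, k) (q, l).
Proof. by exists [::]; rewrite cats0. Qed.

(** Says that [x] lies on H at a point where the edge [e] starts; [q] is the point across it. *)
Definition hit (x : gcar) e (q : vpath) := exists c,
  [/\ over beta c, x.2 ~~ c & sval q = sval x.1 ++ c ++ [:: e]].

Definition gstep e (x : gcar) : gcar :=
  if e \in beta then (x.1, x.2 ++ [:: e]) else
  if pselect (exists q, hit x e q) is left H then (projT1 (cid H), [::]) else x.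

Lemma hit_pth (x : gcar) e (q : vpath) c : sval q = sval x.1 ++ c ++ [:: e] ->
  exists u, pth (endp x.1) c = Some u /\ sg e u = Some (endp q).
Proof.
move=> qE; have := endpE q; rewrite qE pth_cat endpE pth_cat.
case: (pth _ c) => [u|//] /=; case su: (sg e u) => [w|//] [<-].
by exists u.
Qed.

Lemma hit_geq x y e q q' : geq x y -> hit x e q -> hit y e q' ->
  geq (q, [::]) (q', [::]).
Proof.
case=> d [od pd xy kk] [c [oc kc qE]] [c' [oc' kc' qE']].
apply: geq_path; last exact: eqw_refl.
rewrite qE qE' !catA; apply: eqw_catr.
have := eqw_catr c' xy; apply: eqw_trans; rewrite -catA; apply: eqw_catl.
apply: eqw_trans (eqw_sym kc) _; apply: eqw_trans kk _.
exact: eqw_catl.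
Qed.

Lemma gstep_hit x e q : e \notin beta -> hit x e q -> geq (gstep e x) (q, [::]).
Proof.
move=> /negPf eb hq; rewrite /gstep eb; case: pselect => [H|[]]; last by exists q.
by apply: hit_geq (geq_refl x) _ hq; case: cid.
Qed.

Lemma gstep_nohit x e : e \notin beta -> ~ (exists q, hit x e q) -> gstep e x = x.
Proof. by move=> /negPf eb hq; rewrite /gstep eb; case: pselect. Qed.

Lemma hit_transfer x y e q : geq x y -> hit x e q -> exists q', hit y e q'.
Proof.
case=> d [od pd xy kk] [c [oc kc qE]].
have [u [pc se]] := hit_pth qE.
have pq : pth v0 (sval y.1 ++ (rev d ++ c) ++ [:: e]).
  by rewrite pth_cat endpE -catA pth_cat (pth_rev (geq_end pd xy)) pth_cat pc /= se.
exists (mkv pq), (rev d ++ c); split=> //.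
  by rewrite over_cat over_rev od.
apply: eqw_trans (eqw_catl (rev d) kc).
by apply/eqw_divl; apply: eqw_sym.
Qed.

Lemma gstep_proper e x y : geq x y -> geq (gstep e x) (gstep e y).
Proof.
move=> xy; have [eb|eb] := boolP (e \in beta).
  rewrite /gstep eb; case: xy => c [oc pc xy kk]; exists c; split=> //=.
  by rewrite catA; apply: eqw_catr.
have [[q hq]|nq] := pselect (exists q, hit x e q).
  have [q' hq'] := hit_transfer xy hq.
  apply: geq_trans (gstep_hit eb hq) _.
  apply: geq_trans (hit_geq xy hq hq') _.
  exact/geq_sym/gstep_hit.
rewrite (gstep_nohit eb nq) gstep_nohit // => -[q hq].
exact: nq (hit_transfer (geq_sym xy) hq).
Qed.

Lemma gstepK e x : geq (gstep e (gstep e x)) x.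
Proof.
have [eb|eb] := boolP (e \in beta).
  rewrite /gstep eb /=; case: x => p k /=; apply: geq_path; first exact: eqw_refl.
  rewrite -catA -{2}[k]cats0; apply: eqw_catl; exact: (eqwVK (b := bS) [:: e]).
have [[q hq]|nq] := pselect (exists q, hit x e q); last by rewrite !gstep_nohit //; apply: geq_refl.
apply: geq_trans (gstep_proper e (gstep_hit eb hq)) _.
have [c [oc kc qE]] := hq; have [u [pc se]] := hit_pth qE.
have pq : pth v0 (sval q ++ [::] ++ [:: e]).
  by rewrite pth_cat endpE /= (sgK se).
have hq' : hit (q, [::]) e (mkv pq) by exists [::]; split=> //; apply: eqw_refl.
apply: geq_trans (gstep_hit eb hq') _; apply: geq_sym.
exists c; split=> //=; first by rewrite pc.
  rewrite qE -!catA /=; apply: eqw_catl; rewrite -{1}[c]cats0; apply: eqw_catl.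
  exact: eqw_sym (eqwVK (b := bS) [:: e]).
by rewrite cats0.
Qed.

Definition gamma := EAct geq_refl geq_sym geq_trans gstep_proper gstepK.

Lemma gamma_beta (x : gamma) w : over beta w -> erun x w = (x.1, x.2 ++ w).
Proof.
elim: w x => [|e w IH] x /=; first by rewrite cats0; case: x.
by case/andP=> eb ow; rewrite IH //= /gstep eb /= -catA.
Qed.

Lemma gamma_path (p : vpath) (x : gamma) w (pw : pth v0 (sval p ++ w)) :
  geq x (p, [::]) -> geq (erun x w) (mkv pw, [::]).
Proof.
elim: w p x pw => [|e w IH] p x pw xp /=.
  by apply: geq_trans xp _; apply: geq_path; rewrite /= ?cats0; apply: eqw_refl.
have pe : pth v0 (sval p ++ [:: e]).
  by move: pw; rewrite !pth_cat endpE /=; case: (sg e _).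
have pw' : pth v0 ((sval p ++ [:: e]) ++ w) by rewrite -catA.
have -> : mkv pw = mkv pw'.
  by apply: val_inj; rewrite /= -catA.
apply: (IH (mkv pe)); apply: geq_trans (gstep_proper e xp) _.
have [eb|eb] := boolP (e \in beta).
  rewrite /gstep eb /=; apply: geq_sym; exists [:: e]; split=> //=; rewrite ?eb //.
  - have := endpE (mkv pe).
    rewrite pth_cat endpE /=; case se: (sg e _) => [u|//] [<-].
    by rewrite (sgK se).
  - rewrite -catA -{2}[sval p]cats0; apply: eqw_catl; exact: (eqwVK (b := bS) [:: e]).
  - exact: eqw_sym (eqwVK (b := bS) [:: e]).
by apply: gstep_hit => //; exists [::]; split=> //; apply: eqw_refl.
Qed.

Hypothesis B1 : 1 < B0.

(** For [d] inside [beta] the orbit stays in one coset and is regular. Otherwise points are counted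
    by pairs: a path over [d] in H, with few classes by the lowered bound, and a word over
    [d :&: beta]. *)
Lemma gamma_good : good bnd (mu 0) gamma.
Proof.
move=> x d; have [db|ndb] := boolP (d \subset beta); [right; split|left].
- move=> u w ou ow tw; have ob := over_sub db.
  rewrite !gamma_beta ?ob //; apply: geq_path; first exact: eqw_refl.
  rewrite -{2}[x.2 ++ u]cats0; apply: eqw_catl; apply/(bnd_bS (ob _ ow)) => //.
  by apply/eqw_nil; apply: tr_up tw; rewrite ?subsetT.
- move=> u e ou ed; have ob := over_sub db.
  have eb := subsetP db _ ed.
  have ee : erun (S := gamma) (erun x u) [:: e] = (x.1, (x.2 ++ u) ++ [:: e]).
    by rewrite (gamma_beta x (ob _ ou)) gamma_beta //= eb.
  rewrite -[estep e _]/(erun (S := gamma) (erun x u) [:: e]) ee (gamma_beta x (ob _ ou)).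
  case=> c [oc /= pc xc kc].
  have c1 : c ~~ [::].
    by apply: (@eqw_cancell _ _ (sval x.1)); rewrite cats0.
  have : [:: e] ~~ [::].
    apply: (@eqw_cancell _ _ (x.2 ++ u)); rewrite cats0.
    by apply: eqw_trans kc _; apply: (@eqw_catr _ _ _ [::]).
  move/eqw_nil; apply: tr_letter; [exact: bndS_mono| |by rewrite inE].
  exact: leq_trans B1 (bndS_ge _ _).
set n := bn #|d|.-1.
have dpos : 0 < #|d|.
  by rewrite card_gt0; apply: contraNneq ndb => ->; rewrite sub0set.
have pdb : d :&: beta \proper d.
  by rewrite properE subsetIl; apply: contraNN ndb => /subsetIP [].
have ndn : bnd (d :&: beta) <= n.
  by apply: bn_mono; rewrite -ltnS prednK // proper_card.
have nSn : bS d <= n by rewrite /bndS (negPf ndb).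
(* If a point of H is reached inside a coset by a word over [d :&: beta], then also by a path over
   [d :&: beta]. So the recorded path stays over [d]. *)
have red v c u k : over beta c -> pth v c = Some u -> over (d :&: beta) k ->
    k ~~ c -> exists c', [/\ over (d :&: beta) c', pth v c' = Some u & c' ~~ k].
  move=> oc pc ok kc; have okb : over beta k by move: ok; rewrite overI => /andP[].
  have [bd|nbd] := boolP (beta \subset d).
    by exists c; rewrite (setIidPr bd); split=> //; apply: eqw_sym.
  have pbd : d :&: beta \proper beta.
    by rewrite properE subsetIr; apply: contraNN nbd => /subsetIP [].
  have [c' [oc' pc' ck]] := IHbeta pbd pc ok (eqw_sym (iffRL (bnd_bS okb oc) kc)).
  exists c'; split=> //; apply/bnd_bS => //.
  by move: oc'; rewrite overI => /andP[].
pose key (p : vpath) k0 (y : gamma) (a : codeT E n * codeT E n) :=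
  exists (z g : seq E) (q : vpath),
  [/\ over d z, over (d :&: beta) g, sval q = sval p ++ z,
      geq y (q, k0 ++ g) & (code n z, code n g) = a].
have keyP p k0 : (forall u, over d u -> exists i, key p k0 (erun x u) i) ->
    covered d x (mu 0 #|d|).
  move=> /(covered_key (S := gamma)); apply.
    by rewrite /mu expn0 muln1 card_prod -/n -mulnn.
  move=> y y' a [z [g [q [oz og qE yq <-]]]] [z' [g' [q' [oz' og' qE' yq' []]]]].
  move=> /esym zz /esym gg; apply: geq_trans yq _; apply: geq_sym.
  apply: geq_trans yq' _; apply: geq_sym; apply: geq_path.
    by rewrite qE qE'; apply: eqw_catl; exact (eqw_code (@bndS_mono beta) nSn oz oz' zz).
  have ogb := (over_sub (subsetIr d beta)).
  apply: eqw_catl; apply/bnd_bS; rewrite ?ogb //.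
  exact (eqw_code bnd_mono ndn og og' gg).
(* Either letters of [d] lead from [x] within its coset to a point [h] of H, where counting starts,
   or the orbit never leaves this coset. *)
have [[g0 [c0 [og0 oc0 pc0 kc0]]]|noH] := pselect (exists g c : seq E,
    [/\ over (d :&: beta) g, over beta c, pth (endp x.1) c & x.2 ++ g ~~ c]).
  have ph : pth v0 (sval x.1 ++ c0) by rewrite pth_cat endpE.
  pose h : vpath := mkv ph.
  have xh : geq x (h, rev g0).
    exists c0; split=> //; first exact: eqw_refl.
    by apply/eqw_divr.
  apply: (keyP h [::]) => u; elim/last_ind: u => [_|u e IH].
    exists (code n [::], code n (rev g0)), [::], (rev g0), h.
    by rewrite over_rev cats0; split.
  rewrite -cats1 over_cat => /andP[/IH [_ [z [g [q [oz og qE yq _]]]]]].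
  rewrite /= andbT => ed; rewrite cats1 erun_rcons.
  have yq' := gstep_proper e yq.
  have [eb|eb] := boolP (e \in beta).
    exists (code n z, code n (g ++ [:: e])), z, (g ++ [:: e]), q; split=> //.
      by rewrite over_cat og /= inE ed eb.
    by have <- : gstep e (q, g) = (q, g ++ [:: e]) by rewrite /gstep eb.
  have [[q' hq']|nq] := pselect (exists q', hit (q, g) e q'); last first.
    rewrite (gstep_nohit eb nq) in yq'.
    by exists (code n z, code n g), z, g, q.
  have [c [oc kc qE']] := hq'; have [u' [pc se]] := hit_pth qE'.
  have [c' [oc' pc' ck]] := red _ _ _ _ oc pc og kc.
  have pq' : pth v0 (sval q ++ c' ++ [:: e]) by rewrite pth_cat endpE pth_cat pc' /= se.
  exists (code n (z ++ c' ++ [:: e]), code n [::]), (z ++ c' ++ [:: e]), [::], (mkv pq').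
  split=> //; first by rewrite !over_cat oz (over_sub (subsetIl d beta) oc') /= ed.
    by rewrite /= qE -!catA.
  apply: geq_trans yq' _; apply: geq_trans (gstep_hit eb hq') _.
  apply: geq_path; last exact: eqw_refl.
  rewrite qE' /= !catA; apply: eqw_catr; apply: eqw_catl.
  exact: eqw_trans (eqw_sym kc) (eqw_sym ck).
apply: (keyP x.1 x.2) => u ou.
have xu : erun x u = (x.1, x.2 ++ restr beta u).
  elim/last_ind: u ou => [_|u e IH]; first by rewrite cats0; case: (x).
  rewrite -cats1 over_cat /= andbT => /andP[ou ed].
  rewrite cats1 erun_rcons IH // -cats1 restr_cat /=.
  have [eb|eb] := boolP (e \in beta); first by rewrite /gstep eb /= catA.
  rewrite cats0 gstep_nohit // => -[q [c [oc kc qE]]]; apply: noH.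
  exists (restr beta u), c; split=> //; first exact: over_restr.
  by have [u' [-> _]] := hit_pth (x := (x.1, x.2 ++ restr beta u)) qE.
exists (code n [::], code n (restr beta u)), [::], (restr beta u), x.1.
split=> //; [exact: over_restr|by rewrite cats0|rewrite xu].
by apply: geq_path; apply: eqw_refl.
Qed.

(** From the base point, [c] leads along H and [w] stays in the first coset. The ends coincide, and
    the [beta]-path that witnesses this in [geq] is the one sought. *)
Lemma gamma_reduces c u w : pth v0 c = Some u -> over beta w -> eqw bnd c w ->
  exists c', [/\ over beta c', pth v0 c' = Some u & eqw bnd c' w].
Proof.
move=> pc ow cw; pose x0 : gamma := (mkv (p := [::]) isT, [::]).
have pc' : pth v0 c by rewrite pc.
have xc := gamma_path (p := mkv (p := [::]) isT) (x := x0) (w := c) pc' (geq_refl x0).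
have [d [od /= pd dc wd]] := geq_trans (eeq_sym (good_eqw x0 (leq0n R) gamma_good cw)) xc.
move: pd dc wd; rewrite gamma_beta //= cats0 => pd dc wd.
case Ed: (pth v0 d) pd => [u'|] // _; exists d; split=> //.
  by rewrite Ed; congr Some; apply: vend dc Ed pc.
by apply/bnd_bS => //; apply: eqw_sym.
Qed.

End Gamma.

Hypothesis B1 : 1 < B0.

Lemma path_reducesP beta : path_reduces beta.
Proof.
move: {2}(#|beta|.+1) (ltnSn #|beta|) => k.
elim: k beta => // k IH beta bk v c u w pc ow cw.
apply: gamma_reduces pc ow cw => // g gb; apply: IH.
exact: leq_trans (proper_card gb) _.
Qed.

End Paths.
End Covers.

(** * Glueing cosets *)

Section Chains.
Variable E : finType.
Variables (R B0 : nat).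
Implicit Types (d beta gam : {set E}) (e : E) (g h k l w u : seq E).
Local Notation bn := (bn E R B0).
Local Notation bnd := (@bnd E R B0).
Local Notation mu := (mu E R B0).
Local Notation kappa := (kappa E).
Local Notation good := (good bnd).
Local Notation regular := (regular bnd).
Local Notation "u ~~ v" := (eqw bnd u v) (at level 70).

Section Status.
Variables (S : eact E) (m : nat -> nat).

Definition status d (y : S) := covered d y (m #|d|) \/ regular d y.

Lemma status_run d (y z : S) u : over d u -> eeq (erun y u) z -> status d z -> status d y.
Proof.
move=> ou yz.
have yz' v : eeq (erun y v) (erun z (rev u ++ v)).
  rewrite erun_cat; apply/erun_proper/eeq_sym.
  exact: eeq_trans (erun_proper _ (eeq_sym yz)) (erunK _ _).
have ouv v : over d v -> over d (rev u ++ v) by rewrite over_cat over_rev ou.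
case=> [[f cf]|[r1 r2]]; [left|right; split].
- exists f => v /ouv /cf [i zi]; exists i; exact: eeq_trans (yz' v) zi.
- move=> v w ov ow tw; apply: eeq_trans (erun_proper w (yz' v)) _.
  by apply: eeq_trans (eeq_sym (yz' v)); apply: r1 => //; apply: ouv.
- move=> v e ov ed H; apply: (r2 (rev u ++ v) e (ouv _ ov) ed).
  apply: eeq_trans (eeq_trans H (yz' v)).
  exact/estep_proper/eeq_sym.
Qed.

End Status.

(* The coset K[beta] is glued to [S] along the points [x k], [k] over [gam]; a word
   [k] on the right of the sum stands for the point [x k] of the new coset. *)
Section Attach.
Variables (S : eact E) (x : S) (gam beta : {set E}).
Hypothesis hfree : forall k, over gam k -> eeq (erun x k) x <-> tr bnd setT k.
Hypothesis hfix : forall k e, over gam k -> e \in beta -> e \notin gam ->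
  eeq (estep e (erun x k)) (erun x k).

Lemma free_eqw k l : over gam k -> over gam l -> eeq (erun x k) (erun x l) <-> k ~~ l.
Proof.
move=> ok ol; have okl : over gam (k ++ rev l) by rewrite over_cat over_rev ok.
split=> [kl|/hfree].
  apply/hfree => //; rewrite erun_cat.
  exact: eeq_trans (erun_proper _ kl) (erunK _ _).
move=> /(_ okl) /(erun_proper l); rewrite erun_cat => H.
exact: eeq_trans (eeq_sym (erunVK _ _)) H.
Qed.

Definition near (s : S) k := over gam k /\ eeq s (erun x k).

Lemma near_eqw s t k l : eeq s t -> near s k -> near t l -> k ~~ l.
Proof.
move=> st [ok sk] [ol tl]; apply/(free_eqw ok ol).
exact: eeq_trans (eeq_sym sk) (eeq_trans st tl).
Qed.

Lemma near_eeq s t k : eeq s t -> near s k -> near t k.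
Proof. by move=> st [ok sk]; split=> //; apply: eeq_trans (eeq_sym st) sk. Qed.

Definition acar := (S + seq E)%type.

Definition link (s : S) k := exists g, near s g /\ k ~~ g.

Definition aeq (y z : acar) := match y, z with
  | inl s, inl t => eeq s t
  | inl s, inr k => link s k
  | inr k, inl s => link s k
  | inr k, inr l => k ~~ l
  end.

Lemma aeq_refl y : aeq y y.
Proof. by case: y => [s|k]; [apply: eeq_refl|apply: eqw_refl]. Qed.

Lemma aeq_sym y z : aeq y z -> aeq z y.
Proof. by case: y z => [s|k] [t|l] //=; [apply: eeq_sym|apply: eqw_sym]. Qed.

Lemma aeq_trans y z t : aeq y z -> aeq z t -> aeq y t.
Proof.
case: y z t => [s|k] [t|l] [r|m] /=.
- exact: eeq_trans.
- by move=> st [g [ng mg]]; exists g; split=> //; apply: near_eeq ng; apply: eeq_sym.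
- move=> [g [[og sg] lg]] [h [[oh sh] lh]]; apply: eeq_trans sg _.
  apply: eeq_trans (eeq_sym sh); apply/free_eqw => //.
  exact (eqw_trans (eqw_sym lg) lh).
- move=> [g [ng lg]] lm; exists g; split=> //.
  exact (eqw_trans (eqw_sym lm) lg).
- by move=> [g [ng lg]] st; exists g; split=> //; apply: near_eeq ng.
- move=> [g [ng lg]] [h [nh lh]].
  exact (eqw_trans lg (eqw_trans (near_eqw (eeq_refl t) ng nh) (eqw_sym lh))).
- move=> kl [g [ng lg]]; exists g; split=> //.
  exact (eqw_trans kl lg).
- by move=> kl lm; exact (eqw_trans kl lm).
Qed.

(** By [hfix] the letters of [beta] outside [gam] fix the seam in [S], so there they are free to
    lead into the new coset. Letters outside [beta] act as in [S] on the seam and fix the rest of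
    the coset. *)
Definition astep e (y : acar) : acar := match y with
  | inl s =>
      if (e \in beta) && (e \notin gam) then
        if pselect (exists k, near s k) is left H then inr (projT1 (cid H) ++ [:: e])
        else inl (estep e s)
      else inl (estep e s)
  | inr k =>
      if e \in beta then inr (k ++ [:: e]) else
      if pselect (exists g, over gam g /\ k ~~ g) is left H then
        inl (estep e (erun x (projT1 (cid H))))
      else inr k
  end.

Lemma astep_near e s k : e \in beta -> e \notin gam -> near s k ->
  aeq (astep e (inl s)) (inr (k ++ [:: e])).
Proof.
move=> eb eg nk; rewrite /= eb eg /=; case: pselect => [H|[]]; last by exists k.
case: cid => l nl /=; apply: eqw_catr; exact (near_eqw (eeq_refl s) nl nk).
Qed.

Lemma astep_far e s : ~ (exists k, near s k) -> astep e (inl s) = inl (estep e s).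
Proof. by move=> nn /=; case: ifP => // _; case: pselect. Qed.

Lemma astep_old e s : (e \notin beta) || (e \in gam) -> astep e (inl s) = inl (estep e s).
Proof. by move=> eo; rewrite /= ifN // negb_and negbK. Qed.

Lemma astep_out e k g : e \notin beta -> over gam g -> k ~~ g ->
  aeq (astep e (inr k)) (inl (estep e (erun x g))).
Proof.
move=> /negPf eb og kg; rewrite /= eb; case: pselect => [H|[]]; last by exists g.
case: cid => l [ol kl] /=; apply: estep_proper; apply/free_eqw => //.
exact (eqw_trans (eqw_sym kl) kg).
Qed.

Lemma astep_stay e k : e \notin beta -> ~ (exists g, over gam g /\ k ~~ g) ->
  astep e (inr k) = inr k.
Proof. by move=> /negPf eb ng; rewrite /= eb; case: pselect. Qed.

Lemma astep_in e k : e \in beta -> astep e (inr k) = inr (k ++ [:: e]).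
Proof. by move=> /= ->. Qed.

Lemma near_step e s k : e \in gam -> near s k -> near (estep e s) (k ++ [:: e]).
Proof.
move=> eg [ok sk]; split; first by rewrite over_cat ok /= eg.
by rewrite erun_cat; apply: estep_proper.
Qed.

Lemma astep_link e s k : link s k -> aeq (astep e (inl s)) (astep e (inr k)).
Proof.
case=> g [ng kg]; have [eb|eb] := boolP (e \in beta).
  rewrite astep_in //; have [eg|eg] := boolP (e \in gam).
    rewrite astep_old ?eg ?orbT //=; exists (g ++ [:: e]).
    by split; [apply: near_step|apply: eqw_catr].
  apply: aeq_trans (astep_near eb eg ng) _ => /=.
  by apply: eqw_catr; exact (eqw_sym kg).
rewrite astep_old ?eb //; case: (ng) => og sg.
apply: aeq_trans (aeq_sym (astep_out eb og kg)).
exact: estep_proper.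
Qed.

Lemma astep_proper e y z : aeq y z -> aeq (astep e y) (astep e z).
Proof.
case: y z => [s|k] [t|l] yz; [ | exact: astep_link | exact/aeq_sym/astep_link | ].
  have [eo|] := boolP ((e \notin beta) || (e \in gam)).
    by rewrite !astep_old //; apply: estep_proper.
  rewrite negb_or negbK => /andP[eb eg].
  have [[k nk]|nn] := pselect (exists k, near s k).
    apply: aeq_trans (astep_near eb eg nk) _; apply: aeq_sym.
    by apply: astep_near => //; apply: near_eeq nk.
  rewrite !astep_far //; first exact: estep_proper.
  by case=> k nk; apply: nn; exists k; apply: near_eeq nk; apply: eeq_sym.
have [eb|eb] := boolP (e \in beta); first by rewrite !astep_in //; apply: eqw_catr.
have [[g [og kg]]|nn] := pselect (exists g, over gam g /\ k ~~ g).
  apply: aeq_trans (astep_out eb og kg) _; apply/aeq_sym/astep_out => //.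
  exact (eqw_trans (eqw_sym yz) kg).
rewrite !astep_stay // => -[g [og lg]]; apply: nn; exists g; split=> //.
exact (eqw_trans yz lg).
Qed.

Lemma astepK e y : aeq (astep e (astep e y)) y.
Proof.
have inK k : e \in beta -> aeq (astep e (inr (k ++ [:: e]))) (inr k).
  move=> eb; rewrite astep_in //= -catA -{2}[k]cats0; apply: eqw_catl.
  exact: (eqwVK (b := bnd) [:: e]).
case: y => [s|k]; last first.
  have [eb|eb] := boolP (e \in beta); first by rewrite astep_in //; apply: inK.
  have [[g [og kg]]|nn] := pselect (exists g, over gam g /\ k ~~ g); last first.
    by rewrite !astep_stay //; apply: aeq_refl.
  apply: aeq_trans (astep_proper e (astep_out eb og kg)) _.
  rewrite astep_old ?eb //=; exists g; split=> //; split=> //.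
  exact: estepK.
have [eo|] := boolP ((e \notin beta) || (e \in gam)).
  by rewrite !astep_old //; apply: estepK.
rewrite negb_or negbK => /andP[eb eg].
have [[k nk]|nn] := pselect (exists k, near s k).
  apply: aeq_trans (astep_proper e (astep_near eb eg nk)) _.
  apply: aeq_trans (inK k eb) _ => /=; exists k; split=> //; exact: eqw_refl.
(* No point off the seam steps onto it, since [e] fixes the seam in [S]. *)
rewrite astep_far // astep_far; first exact: estepK.
case=> k [ok sk]; apply: nn; exists k; split=> //.
apply: eeq_trans (eeq_sym (estepK e s)) _.
exact: eeq_trans (estep_proper e sk) (hfix ok eb eg).
Qed.

Definition attach := EAct aeq_refl aeq_sym aeq_trans astep_proper astepK.

Lemma attach_inr k w : over beta w -> erun (S := attach) (inr k) w = inr (k ++ w).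
Proof.
elim: w k => [|e w IH] k /=; first by rewrite cats0.
by move=> /andP[eb ow]; rewrite eb IH // -catA.
Qed.

Lemma link_near k : over gam k -> aeq (inl (erun x k)) (inr k).
Proof. by move=> ok; exists k; split; [split=> //; apply: eeq_refl|apply: eqw_refl]. Qed.

Hypothesis B1 : 1 < B0.
Variable m : nat -> nat.
Hypothesis mpos : forall k : nat, 0 < m k.
Hypothesis gS : good m S.

Let m' (k : nat) := m k * (1 + kappa (bn k.-1)).

Let mm' (k : nat) : m k <= m' k. Proof. exact: leq_pmulr. Qed.

(** A regular orbit is unchanged: a letter of [d] in [beta] but outside [gam] would fix [s]. A small
    orbit gains at most [kappa] points for each old one, hence the factor. *)
Lemma attach_status_near d k : over gam k -> ~~ (d \subset beta) ->
  status (S := attach) m' d (inl (erun x k)).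
Proof.
move=> ok ndb; set s := erun x k; set n := bn #|d|.-1.
have dpos : 0 < #|d|.
  by rewrite card_gt0; apply: contraNneq ndb => ->; rewrite sub0set.
have pdb : d :&: beta \proper d.
  by rewrite properE subsetIl; apply: contraNN ndb => /subsetIP [].
have ndn : bnd (d :&: beta) <= n.
  by apply: bn_mono; rewrite -ltnS prednK // proper_card.
case: (gS s d) => [[f cf]|[r1 r2]]; last first.
  have dg e : e \in d -> e \in beta -> e \in gam.
    move=> ed eb; apply: contraT => eg; case: (r2 [::] e isT ed).
    exact: hfix.
  have run u : over d u -> erun (S := attach) (inl s) u = inl (erun s u).
    elim/last_ind: u => // u e IH; rewrite -cats1 over_cat /= andbT => /andP[ou ed].
    rewrite cats1 !erun_rcons IH //; apply: astep_old.
    by have [eb|//] := boolP (e \in beta); rewrite dg // orbT.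
  right; split=> [u w ou ow tw|u e ou ed].
    rewrite -erun_cat !run ?over_cat ?ou // erun_cat; exact: r1.
  rewrite -erun_rcons !run // -?cats1 ?over_cat ?ou /= ?ed // cats1 erun_rcons.
  exact: r2.
left; pose key (y : attach) (a : 'I_(m #|d|) * option (codeT E n)) :=
  exists t, eeq t (f a.1) /\ match a.2 with
  | None => aeq y (inl t)
  | Some c => exists g w, [/\ near t g, over (d :&: beta) w, code n w = c &
                              aeq y (inr (g ++ w))] end.
apply: (covered_key (S := attach) (K := key)).
- by rewrite card_prod card_option card_ord /m' add1n.
- suff H u : over d u -> (exists2 v, over d v & aeq (erun (S := attach) (inl s) u) (inl (erun s v)))
    \/ (exists v g w, [/\ over d v, near (erun s v) g, over (d :&: beta) w &
          aeq (erun (S := attach) (inl s) u) (inr (g ++ w))]).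
    move=> u /H [[v ov uv]|[v [g [w [ov ng ow uv]]]]]; have [i vi] := cf v ov.
      by exists (i, None), (erun s v).
    by exists (i, Some (code n w)), (erun s v); split=> //; exists g, w.
  elim/last_ind: u => [_|u e IH]; first by left; exists [::] => //; apply: aeq_refl.
  rewrite -cats1 over_cat /= andbT => /andP[/IH {}IH ed]; rewrite cats1 erun_rcons.
  case: IH => [[v ov uv]|[v [g [w [ov ng ow uv]]]]].
    have uv' := astep_proper e uv.
    have [[g ng]|nn] := pselect (exists g, near (erun s v) g); last first.
      left; exists (rcons v e); first by rewrite -cats1 over_cat ov /= ed.
      by rewrite erun_rcons -astep_far.
    have [eo|] := boolP ((e \notin beta) || (e \in gam)).
      left; exists (rcons v e); first by rewrite -cats1 over_cat ov /= ed.
      by rewrite erun_rcons -astep_old.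
    rewrite negb_or negbK => /andP[eb eg].
    right; exists v, g, [:: e]; split=> //=; first by rewrite inE ed eb.
    exact: aeq_trans uv' (astep_near eb eg ng).
  have uv' := astep_proper e uv.
  have [eb|eb] := boolP (e \in beta).
    right; exists v, g, (w ++ [:: e]); split=> //.
      by rewrite over_cat ow /= inE ed eb.
    by rewrite astep_in // -catA in uv'.
  have [[h [oh gh]]|nn] := pselect (exists h, over gam h /\ g ++ w ~~ h); last first.
    rewrite astep_stay // in uv'.
    by right; exists v, g, w.
  have [og sg] := ng.
  (* A word that returns to the seam is congruent to one over [gam]. Deleting its other letters
     keeps it over [d] as well, so the point is already in the old orbit. *)
  have owg : restr gam w ~~ w.
    have wE : w ~~ rev g ++ h by exact/eqw_divl.
    apply: eqw_trans (eqw_sym wE).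
    have := eqw_restr (@bnd_mono E R B0) gam wE.
    by rewrite [X in _ ~~ X -> _]over_restr_id // over_cat over_rev og.
  left; exists (v ++ restr gam w ++ [:: e]).
    rewrite !over_cat ov /= ed !andbT.
    apply: over_sub (over_restr gam ow).
    exact: subset_trans (subsetIl _ _) (subsetIl _ _).
  apply: aeq_trans uv' _; apply: aeq_trans (astep_out eb oh gh) _ => /=.
  rewrite 2!erun_cat; apply: estep_proper.
  have hE : h ~~ g ++ restr gam w.
    by apply: eqw_trans (eqw_sym gh) _; apply: eqw_catl; exact (eqw_sym owg).
  have og' : over gam (g ++ restr gam w).
    rewrite over_cat og /=; have := over_restr gam (overT w); rewrite setTI; exact.
  apply: eeq_trans (iffRL (free_eqw oh og') hE) _; rewrite erun_cat.
  exact/erun_proper/eeq_sym.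
move=> y z [i [c|]] [t [ti /=]].
  case=> g [w [ng ow <- yw]] [t' [t'i [g' [w' [ng' ow' cw zw]]]]].
  apply: aeq_trans yw _; apply: aeq_trans (aeq_sym zw) => /=.
  apply: eqw_cat.
    exact (near_eqw (eeq_trans ti (eeq_sym t'i)) ng ng').
  exact (eqw_code (@bnd_mono E R B0) ndn ow ow' (esym cw)).
move=> yt [t' [t'i /= zt]]; apply: aeq_trans yt _; apply: aeq_trans (aeq_sym zt).
exact: eeq_trans ti (eeq_sym t'i).
Qed.

(** For [d] not inside [beta], the orbit either meets the seam, as in [attach_status_near], or stays
    in the coset and is counted by codes. *)
Lemma attach_status_inr d k : status (S := attach) m' d (inr k).
Proof.
have [db|ndb] := boolP (d \subset beta).
  right; have ob := over_sub db; split=> [u w ou ow tw|u e ou ed].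
    rewrite !attach_inr ?ob //= -{2}[k ++ u]cats0; apply: eqw_catl.
    by apply/eqw_nil; apply: tr_up tw; rewrite ?subsetT.
  have eb := subsetP db _ ed; rewrite attach_inr ?ob //= eb => H.
  have : [:: e] ~~ [::] by apply: (@eqw_cancell _ _ (k ++ u)); rewrite cats0.
  move/eqw_nil; apply: tr_letter; [exact: bnd_mono| |by rewrite inE].
  exact: leq_trans B1 (bn_ge _ _ _ _).
have [[u [g [ou og ug]]]|nn] := pselect (exists u g,
    [/\ over (d :&: beta) u, over gam g & k ++ u ~~ g]).
  move: ou; rewrite overI => /andP[ou oub].
  apply: (status_run ou) (attach_status_near og ndb).
  rewrite attach_inr //; change (aeq (inr (k ++ u)) (inl (erun x g))).
  by apply: aeq_trans (aeq_sym (link_near og)).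
left; set n := bn #|d|.-1.
have dpos : 0 < #|d|.
  by rewrite card_gt0; apply: contraNneq ndb => ->; rewrite sub0set.
have pdb : d :&: beta \proper d.
  by rewrite properE subsetIl; apply: contraNN ndb => /subsetIP [].
have ndn : bnd (d :&: beta) <= n.
  by apply: bn_mono; rewrite -ltnS prednK // proper_card.
apply: (covered_key (S := attach) (I := codeT E n)
   (K := fun y c => exists w, [/\ over (d :&: beta) w, code n w = c & aeq y (inr (k ++ w))])).
- change (kappa n <= m' #|d|); rewrite /m' -/n mulnDr muln1.
  by apply: leq_trans (leq_addl _ _); apply: leq_pmull.
- move=> u ou; exists (code n (restr beta u)), (restr beta u); split=> //.
    exact: over_restr.
  suff -> : erun (S := attach) (inr k) u = inr (k ++ restr beta u) by apply: aeq_refl.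
  elim/last_ind: u ou => [_|u e IH]; first by rewrite cats0.
  rewrite -cats1 over_cat /= andbT => /andP[ou ed].
  rewrite cats1 erun_rcons IH // -cats1 restr_cat /=.
  have [eb|eb] := boolP (e \in beta); first by rewrite -catA.
  rewrite cats0; case: pselect => // -[g [og ug]]; case: nn.
  by exists (restr beta u), g; split=> //; apply: over_restr.
- move=> y z c [w [ow <- yw]] [w' [ow' cw zw]].
  apply: aeq_trans yw _; apply: aeq_trans (aeq_sym zw) => /=.
  apply: eqw_catl; exact (eqw_code (@bnd_mono E R B0) ndn ow ow' (esym cw)).
Qed.

Lemma attach_good : good m' attach.
Proof.
move=> [s|k] d; last exact: attach_status_inr.
have [[u [k [ou uk]]]|nn] := pselect (exists u k,
    over d u /\ aeq (erun (S := attach) (inl s) u) (inr k)).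
  exact (status_run (S := attach) ou uk (attach_status_inr d k)).
have run u : over d u -> erun (S := attach) (inl s) u = inl (erun s u).
  elim/last_ind: u => // u e IH; rewrite -cats1 over_cat /= andbT => /andP[ou ed].
  rewrite cats1 !erun_rcons IH //; apply: astep_far => -[k [ok uk]].
  apply: nn; exists u, k; split=> //; rewrite IH //.
  by apply: aeq_trans (link_near ok).
case: (gS s d) => [[f cf]|[r1 r2]]; [left|right; split].
- apply: (covered_le (mm' _)); exists (fun i => inl (f i)) => u ou.
  by have [i ui] := cf u ou; exists i; rewrite run.
- move=> u w ou ow tw.
  rewrite -erun_cat !run ?over_cat ?ou // erun_cat; exact: r1.
- move=> u e ou ed.
  rewrite -erun_rcons !run // -?cats1 ?over_cat ?ou /= ?ed // cats1 erun_rcons.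
  exact: r2.
Qed.

End Attach.
End Chains.

(** * Chains of cosets *)

Section Chains2.
Variable E : finType.
Variables (R B0 : nat).
Hypothesis B1 : 1 < B0.
Implicit Types (d beta gam : {set E}) (e : E) (g h k l w u : seq E).
Local Notation bnd := (@bnd E R B0).
Local Notation mu := (mu E R B0).
Local Notation good := (good bnd).
Local Notation "u ~~ v" := (eqw bnd u v) (at level 70).

Definition splits d d' w := exists a b, [/\ over d a, over d' b & w ~~ a ++ b].

(** Non-degeneracy at every link but the last; [beta] is the label of the link before the first. *)
Fixpoint chain_ok beta (s : seq ({set E} * seq E)) : Prop :=
  if s is (b1, c1) :: s' then
    if s' is (b2, _) :: _ then
      ~ splits (beta :&: b1) (b1 :&: b2) c1 /\ chain_ok b1 s'
    else True
  else True.

Definition chain_word (s : seq ({set E} * seq E)) := flatten (map snd s).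

Definition chain_over (s : seq ({set E} * seq E)) := all (fun c => over c.1 c.2) s.

(* The walk [U] leads from [y] to [x]; the coset of [beta]-words at [x] is
   regular, and those of its points that satisfy [fresh] are met neither by [y]
   nor by the earlier part of the walk. *)
Record tip (S : eact E) (j : nat) (y : S) U (x : S) beta (fresh : seq E -> Prop) := Tip {
  tip_good : good (mu j) S;
  tip_run : eeq (erun y U) x;
  tip_trace : forall U1 e U2 g, U = U1 ++ e :: U2 -> e \notin beta ->
    over beta g -> fresh g -> ~ eeq (erun y U1) (erun x g);
  tip_start : forall g, over beta g -> fresh g -> ~ eeq y (erun x g);
  tip_free : forall g, over beta g -> eeq (erun x g) x <-> tr bnd setT g;
  tip_fix : forall g e, over beta g -> fresh g -> e \notin beta ->
    eeq (estep e (erun x g)) (erun x g)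
}.

Section Step.
Variables (S : eact E) (j : nat) (y : S) (U : seq E) (x : S) (beta : {set E}).
Variables (fresh : seq E -> Prop) (beta' : {set E}) (c : seq E).
Hypothesis tS : tip j y U x beta fresh.
Let gam := beta :&: beta'.
Hypothesis fgam : forall g, over gam g -> fresh g.
Hypothesis oc : over beta' c.

Let ogb g : over gam g -> over beta g.
Proof. exact: over_sub (subsetIl _ _). Qed.

Let hfree g : over gam g -> eeq (erun x g) x <-> tr bnd setT g.
Proof. by move=> og; apply: (tip_free tS); apply: ogb. Qed.

Let hfix g e : over gam g -> e \in beta' -> e \notin gam ->
  eeq (estep e (erun x g)) (erun x g).
Proof.
move=> og eb eg; apply: (tip_fix tS); [exact: ogb|exact: fgam|].
by apply: contraNN eg => ebeta; rewrite inE ebeta.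
Qed.

Definition next := attach hfree hfix.

(** The points of the new coset off the seam, in coordinates at the new tip. *)
Definition next_fresh g := ~ exists2 h, over gam h & c ++ g ~~ h.

(** A diversion into the new coset needs a letter of [beta'] outside [beta] at a point of the seam,
    which [tip_trace] excludes. *)
Lemma next_run U1 U2 : U = U1 ++ U2 -> erun (S := next) (inl y) U1 = inl (erun y U1).
Proof.
elim/last_ind: U1 U2 => // U1 e IH U2; rewrite -cats1 -catA /= => UE.
rewrite cats1 !erun_rcons (IH _ UE).
have [eb|eb] := boolP (e \in beta).
  apply: astep_old; rewrite inE eb /=; exact: orNb.
apply: astep_far => -[g [og xg]].
by apply: (tip_trace tS UE eb (ogb og) (fgam og)).
Qed.

Lemma next_end : eeq (erun (S := next) (inl y) (U ++ c)) (inr c).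
Proof.
rewrite erun_cat (@next_run U [::]) ?cats0 //.
rewrite -[c in X in _ X]/([::] ++ c) -[inr _](attach_inr hfree hfix [::] oc).
apply: erun_proper; exists [::]; split; last exact: eqw_refl.
by split=> //; apply: (tip_run tS).
Qed.

Lemma next_tip : tip (S := next) j.+1 (inl y) (U ++ c) (inr c) beta' (next_fresh).
Proof.
have far g s : over beta' g -> next_fresh g ->
    ~ eeq (e0 := next) (inl s) (erun (S := next) (inr c) g).
  move=> og fg; rewrite attach_inr // => -[h [[oh _] ch]].
  by apply: fg; exists h.
split.
- have H := attach_good (hfree := hfree) (hfix := hfix) B1
    (@mu_gt0 E R B0 j) (tip_good tS).
  by move=> z d; have := H z d; rewrite muS.
- exact: next_end.
- move=> U1 e U2 g UE eb og fg.
  (* As [e] is outside [beta'], it does not occur in [c]. *)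
  have [W UW] : exists W, U = U1 ++ W.
    have : size U1 <= size U \/ size U < size U1 by case: leqP; [left|right].
    case=> sU.
      exists (drop (size U1) U); have := congr1 (take (size U1)) UE.
      rewrite [RHS]take_size_cat // take_cat; case: ltnP => sU'.
        by move=> tE; rewrite -{1}tE cat_take_drop.
      have -> : size U1 = size U by apply/eqP; rewrite eqn_leq sU.
      by rewrite subnn take0 drop_size !cats0 => ->.
    have := congr1 (drop (size U)) UE; rewrite [LHS]drop_size_cat // drop_cat sU.
    move=> cE; have := oc; rewrite cE over_cat /= (negPf eb) andbF //.
  by rewrite (next_run UW); apply: far.
- by move=> g og fg; apply: far.
- move=> g og; rewrite attach_inr //=; split=> H.
    by apply/eqw_nil; apply: (@eqw_cancell _ _ c); rewrite cats0.
  by rewrite -{2}[c]cats0; apply/eqw_catl/eqw_nil.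
- move=> g e og fg eb; rewrite attach_inr //.
  have -> : estep (e0 := next) e (inr (c ++ g)) = inr (c ++ g).
    by apply: astep_stay => // -[h [oh ch]]; apply: fg; exists h.
  exact: eqw_refl.
Qed.

(** A relator would identify the end of the walk with [y], which would put [y] on the seam against
    [tip_start]. *)
Lemma next_contra : j.+1 <= R -> ~ tr bnd setT (U ++ c).
Proof.
move=> jR tU; have := good_tr (S := next) (inl y) jR (tip_good next_tip) tU.
move=> /(aeq_trans hfree (aeq_sym next_end)) [g [[og yg] _]].
exact: (tip_start tS (ogb og) (fgam og)).
Qed.

End Step.

(** The cosets are attached one by one; as a link does not split, the next seam consists of fresh
    points. *)
Lemma chain_contra s : forall (S : eact E) j (y : S) U (x : S) beta fresh b1 c1,
  tip j y U x beta fresh -> chain_over ((b1, c1) :: s) ->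
  (forall g, over (beta :&: b1) g -> fresh g) ->
  chain_ok beta ((b1, c1) :: s) -> j + (size s).+1 <= R ->
  ~ tr bnd setT (U ++ chain_word ((b1, c1) :: s)).
Proof.
elim: s => [|[b2 c2] s IH] S j y U x beta fresh b1 c1 tS /=.
  rewrite /= andbT addn1 => oc fg _ jR; rewrite /chain_word /= cats0.
  exact: (next_contra tS fg oc).
move=> /andP[oc os] fg [ns ok] jR; rewrite /chain_word /= catA.
apply: (IH _ _ _ _ _ _ _ b2 c2 (next_tip tS fg oc)) => //; last by rewrite addSnnS.
move=> g og [h oh ch]; apply: ns; exists h, (rev g); split=> //.
  by rewrite over_rev.
by apply/eqw_divr.
Qed.

Section Graph.
Variables (V : finType) (sg : E -> V -> option V).
Hypothesis sgK : forall e (v u : V), sg e v = Some u -> sg e u = Some v.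
Hypothesis VB : #|V| <= B0.
Variable v0 : V.
Local Notation pth := (pth sg).

(** Walk from the end of [q] in H back to the base point, then along [c1] in its coset. If [c1] did
    not split, the seam with the second coset would avoid H, and attaching the other cosets would
    contradict the closing relator. *)
Lemma chain_split q b1 c1 s : pth v0 q -> chain_over ((b1, c1) :: s) ->
  s != [::] -> chain_ok b1 s -> size s <= R -> q ~~ chain_word ((b1, c1) :: s) ->
  exists a b, [/\ over b1 a, isSome (pth v0 a), over (b1 :&: (head (set0, [::]) s).1) b & c1 ~~ a ++ b].
Proof.
case: s => [//|[b2 c2] s] pq oall _ ok sR qc /=.
have /= /andP[oc1 os] := oall.
apply: contrapT => nsplit.
pose S := gamma R sgK VB b1 v0.
pose x0 : S := (mkv (p := [::]) isT, [::]); pose y : S := (mkv pq, [::]).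
pose fresh g := ~ exists a, [/\ over b1 a, isSome (pth v0 a) & c1 ++ g ~~ a].
have pth_mk p (pp : pth v0 p) : eeq (erun x0 p) (mkv pp, [::]).
  exact: (gamma_path (p := mkv (p := [::]) isT) (x := x0) (w := p) pp (geq_refl R B0 b1 x0)).
pose x : S := (mkv (p := [::]) isT, c1).
have xg g : over b1 g -> erun x g = (mkv (p := [::]) isT, c1 ++ g).
  by move=> og; rewrite gamma_beta.
have far g p (pp : pth v0 p) : over b1 g -> fresh g -> ~ eeq (e0 := S) (mkv pp, [::]) (erun x g).
  move=> og fg; rewrite xg // => /eeq_sym [a [oa pa _ ca]]; apply: fg.
  rewrite /= cats0 in ca pa; exists a; split=> //.
  by apply/(bnd_bS R B0 (beta := b1)); rewrite ?over_cat ?oc1.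
have tS : tip (S := S) 0 y (rev q ++ c1) x b1 fresh.
  split.
  - exact: gamma_good (fun d _ => path_reducesP sgK VB B1 (beta := d)) B1.
  - rewrite erun_cat; have : eeq (erun y (rev q)) x0.
      exact: eeq_trans (erun_proper _ (eeq_sym (pth_mk _ pq))) (erunK _ _).
    by move=> /(erun_proper c1) /eeq_trans; apply; rewrite gamma_beta //; apply: eeq_refl.
  - move=> U1 e U2 g UE eb og fg.
    (* The letter [e] cannot belong to [c1], so [U1] retraces a final part of [q] and ends in H. *)
    have [W qW] : exists W, q = W ++ rev U1.
      have : size U1 <= size q \/ size q < size U1 by case: leqP; [left|right].
      case=> sU.
        exists (rev (drop (size U1) (rev q))).
        rewrite -rev_cat -{1}[q]revK; congr rev.
        have := congr1 (take (size U1)) UE.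
        rewrite [RHS]take_size_cat // take_cat size_rev; case: ltnP => sU'.
          by move=> tE; rewrite -{1}tE cat_take_drop.
        have -> : size U1 = size q by apply/eqP; rewrite eqn_leq sU.
        by rewrite subnn take0 -(size_rev q) drop_size !cats0 => ->.
      have := congr1 (drop (size (rev q))) UE.
      rewrite [LHS]drop_size_cat // drop_cat size_rev sU.
      by move=> cE; have := oc1; rewrite cE over_cat /= (negPf eb) andbF.
    have pW : pth v0 W by have := pq; rewrite qW pth_cat; case: (pth v0 W).
    have yW : eeq (erun y U1) (mkv pW, [::]).
      apply: eeq_trans (pth_mk _ pW).
      apply: eeq_trans (erun_proper _ (eeq_sym (pth_mk _ pq))) _.
      by rewrite qW erun_cat; apply: erunVK.
    by move=> H; apply: (far g W pW og fg); apply: eeq_trans (eeq_sym yW) H.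
  - by move=> g og fg; apply: far.
  - move=> g og; rewrite xg //; split=> [[a [oa /= pa aE cE]]|tg].
      have a1 : eqw (bndS R B0 b1) a [::] by [].
      have cg : eqw (bndS R B0 b1) (c1 ++ g) (c1 ++ [::]).
        by apply: eqw_trans cE _; rewrite cats0; apply: (eqw_catr c1 a1).
      have := eqw_cancell cg; move/(bnd_bS R B0 (beta := b1)) => /(_ og isT) /eqw_nil; exact.
    apply: geq_path; first exact: eqw_refl.
    by rewrite -{2}[c1]cats0; apply: eqw_catl; apply/(bnd_bS R B0) => //; apply/eqw_nil.
  - move=> g e og fg eb; rewrite xg //.
    have -> : estep (e0 := S) e (mkv (p := [::]) isT, c1 ++ g) = (mkv (p := [::]) isT, c1 ++ g).
      apply: gstep_nohit => // -[p [a [oa ca pE]]]; apply: fg; exists a; split=> //.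
        by have [u [-> _]] := hit_pth pE.
      by apply/(bnd_bS R B0 (beta := b1)); rewrite ?over_cat ?oc1.
    exact: eeq_refl.
apply: (chain_contra tS os _ ok sR); last first.
  apply/eqw_nil; rewrite -catA; apply: eqw_sym.
  have := eqw_catl (rev q) qc; rewrite /chain_word /=.
  by apply: eqw_trans; apply/eqw_sym/eqwK.
move=> g og [a [oa pa ca]]; apply: nsplit; exists a, (rev g); split=> //.
  by rewrite over_rev.
by apply/eqw_divr.
Qed.

(** A chain of two cosets yields the path [a]; the rest of [q] is then congruent to a word over [d2]
    and becomes a path by [path_reducesP]. *)
Lemma path_split q (u : V) d1 d2 w1 w2 : 0 < R -> pth v0 q = Some u ->
  over d1 w1 -> over d2 w2 -> q ~~ w1 ++ w2 ->
  exists a b, [/\ over d1 a, over d2 b, pth v0 (a ++ b) = Some u & q ~~ a ++ b].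
Proof.
move=> R1 pq o1 o2 qw.
have pq' : isSome (pth v0 q) by rewrite pq.
have oo : chain_over [:: (d1, w1); (d2, w2)] by rewrite /= o1 o2.
have qc : q ~~ chain_word [:: (d1, w1); (d2, w2)] by rewrite /chain_word /= cats0.
have [a [b [oa pa ob wab]]] := chain_split pq' oo isT I R1 qc.
rewrite /= in ob.
case pa' : (pth v0 a) pa => [v|//] _.
have pv : pth v (rev a ++ q) = Some u by rewrite pth_cat (pth_rev sgK pa') pq.
have ov : over d2 (b ++ w2) by rewrite over_cat o2 (over_sub _ ob) ?subsetIr.
have qv : rev a ++ q ~~ b ++ w2.
  apply/eqw_divl; rewrite revK catA.
  exact (eqw_trans qw (eqw_catr _ wab)).
have [c [oc pc cE]] := path_reducesP sgK VB B1 pv ov qv.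
exists a, c; split=> //; first by rewrite pth_cat pa'.
have H : c ~~ rev a ++ q := eqw_trans cE (eqw_sym qv).
by apply: eqw_sym; apply/eqw_divl.
Qed.
End Graph.

(** In the graph with one vertex and a loop for each letter of [d], paths are words over [d]. *)
Lemma word_cycle d q b1 c1 s : over d q -> chain_over ((b1, c1) :: s) ->
  chain_ok b1 s -> size s <= R -> q ~~ chain_word ((b1, c1) :: s) ->
  splits (d :&: b1) (b1 :&: (head (d, [::]) s).1) c1.
Proof.
move=> oq oc ok sR qc; have /= /andP[o1 _] := oc.
pose sg e (v : unit) := if e \in d then Some tt else None.
have sgK e (v u : unit) : sg e v = Some u -> sg e u = Some v.
  by case: v u => [] []; rewrite /sg.
have VB : #|{: unit}| <= B0 by rewrite card_unit ltnW.
have sgP w : isSome (pth sg tt w) = over d w.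
  by elim: w => //= e w IH; rewrite /sg; case: (e \in d).
have pq : pth sg tt q by rewrite sgP.
case: s oc ok sR qc => [|[b2 c2] s] oc ok sR qc.
  rewrite /chain_word /= cats0 in qc.
  case Eq: (pth sg tt q) pq => [[]|//] _.
  have [a [oa pa aE]] := path_reducesP sgK VB B1 Eq o1 qc.
  exists a, [::]; rewrite cats0; split=> //; last exact: eqw_sym.
  by rewrite overI oa -sgP pa.
have [a [b [oa pa ob cE]]] := chain_split sgK VB pq oc isT ok sR qc.
by exists a, b; split=> //; rewrite overI oa -sgP pa.
Qed.

End Chains2.

(** * Networks of least weight *)

Section Networks.
Variables (E : finType) (G : eqType).
Definition ledge := (G * G * {set E})%type.
Implicit Types (d : {set E}) (P Q : {set E} -> Prop) (Ed : seq ledge) (e : ledge).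

Inductive conn P Ed : G -> G -> Prop :=
| conn_refl a : conn P Ed a a
| conn_edge e : e \in Ed -> P e.2 -> conn P Ed e.1.1 e.1.2
| conn_sym a b : conn P Ed a b -> conn P Ed b a
| conn_trans b a c : conn P Ed a b -> conn P Ed b c -> conn P Ed a c.

Definition any d := True.

Lemma conn_subst P Q Ed Ed' a b :
  (forall e, e \in Ed -> P e.2 -> conn Q Ed' e.1.1 e.1.2) ->
  conn P Ed a b -> conn Q Ed' a b.
Proof.
move=> H; elim=> [x|e eE Pe|x y _ xy|y x z _ xy _ yz].
- exact: conn_refl.
- exact: H.
- exact: conn_sym.
- exact: conn_trans xy yz.
Qed.

Lemma conn_mono P Q Ed Ed' a b :
  (forall d, P d -> Q d) -> {subset Ed <= Ed'} -> conn P Ed a b -> conn Q Ed' a b.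
Proof.
by move=> PQ EE; apply: conn_subst => e eE Pe; apply: conn_edge; [apply: EE|apply: PQ].
Qed.

(** A connection needs the added edge at most once, in one of its directions. *)
Lemma conn_cons P Ed e a b : conn P (e :: Ed) a b ->
  [\/ conn P Ed a b, P e.2 /\ conn P Ed a e.1.1 /\ conn P Ed e.1.2 b |
      P e.2 /\ conn P Ed a e.1.2 /\ conn P Ed e.1.1 b].
Proof.
elim=> {a b} [a|e' eE Pe|a b _ IH|b a c _ IH1 _ IH2].
- by apply: Or31; apply: conn_refl.
- move: eE Pe; rewrite inE => /predU1P[-> Pe|eE Pe].
    by apply: Or32; do !split=> //; apply: conn_refl.
  by apply: Or31; apply: conn_edge.
- case: IH => [ab|[Pe [a1 b2]]|[Pe [a2 b1]]].
  + by apply: Or31; apply: conn_sym.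
  + by apply: Or33; do !split=> //; apply: conn_sym.
  + by apply: Or32; do !split=> //; apply: conn_sym.
- case: IH1 => [ab|[Pe [a1 b2]]|[Pe [a2 b1]]];
  case: IH2 => [bc|[Pe' [b1' c2]]|[Pe' [b2' c1]]].
  + by apply: Or31; apply: conn_trans ab bc.
  + by apply: Or32; do !split=> //; apply: conn_trans ab b1'.
  + by apply: Or33; do !split=> //; apply: conn_trans ab b2'.
  + by apply: Or32; do !split=> //; apply: conn_trans b2 bc.
  + by apply: Or32; do !split.
  + by apply: Or31; apply: conn_trans a1 c1.
  + by apply: Or33; do !split=> //; apply: conn_trans b1 bc.
  + by apply: Or31; apply: conn_trans a2 c2.
  + by apply: Or33; do !split.
Qed.

Definition tail (a : G) (s : seq ({set E} * G)) := last a (map snd s).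

Lemma tail_cat a s s' : tail a (s ++ s') = tail (tail a s) s'.
Proof. by rewrite /tail map_cat last_cat. Qed.

Fixpoint trail (step : {set E} -> G -> G -> Prop) (a : G) (s : seq ({set E} * G)) : Prop :=
  if s is (d, b) :: s' then step d a b /\ trail step b s' else True.

Lemma trail_cat step a s s' :
  trail step a (s ++ s') <-> trail step a s /\ trail step (tail a s) s'.
Proof.
elim: s a => [|[d b] s IH] a /=; first by split=> // -[].
by rewrite IH; split=> [[? []]|[[]]].
Qed.

Lemma trail_mono (step step' : {set E} -> G -> G -> Prop) a s :
  (forall d x y, step d x y -> step' d x y) -> trail step a s -> trail step' a s.
Proof. by move=> H; elim: s a => //= -[d b] s IH a [/H ? /IH]. Qed.

Definition sub_conn Ed d := conn (fun d' => d' \subset d) Ed.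

Lemma sub_connS Ed d d' a b : d \subset d' -> sub_conn Ed d a b -> sub_conn Ed d' a b.
Proof. by move=> dd; apply: conn_mono => // c cd; apply: subset_trans cd dd. Qed.

Definition labels P (s : seq ({set E} * G)) := forall c, c \in s -> P c.1.

Lemma conn_trail P Ed a b : conn P Ed a b -> exists s,
  [/\ trail (sub_conn Ed) a s, tail a s = b, labels P s & size s < 2 ^ size Ed].
Proof.
elim: Ed a b => [|e Ed IH] a b ab.
  by exists [::]; split=> //; elim: ab => {a b} [//|//|x y _ <- //|y x z _ <- _ <-].
have sub x s : trail (sub_conn Ed) x s -> trail (sub_conn (e :: Ed)) x s.
  apply: trail_mono => d y z; apply: conn_mono => // f fE.
  by rewrite inE fE orbT.
have sz m n : m < 2 ^ size Ed -> n < 2 ^ size Ed -> m + n.+1 < 2 ^ size (e :: Ed).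
  by move=> mE nE; rewrite /= expnS mul2n -addnn -addSn; apply: leq_add.
have eE : e \in e :: Ed by rewrite inE eqxx.
have two c x : sub_conn (e :: Ed) e.2 c x -> P e.2 -> conn P Ed a c -> conn P Ed x b ->
    exists s, [/\ trail (sub_conn (e :: Ed)) a s, tail a s = b, labels P s &
                 size s < 2 ^ size (e :: Ed)].
  move=> cd Pe /IH [s [ts ls Ps ss]] /IH [s' [ts' ls' Ps' ss']].
  exists (s ++ (e.2, x) :: s'); split.
  - by apply/trail_cat; rewrite ls /=; do !split=> //; apply: sub.
  - by rewrite tail_cat ls.
  - move=> f; rewrite mem_cat inE => /or3P[/Ps //|/eqP -> //|/Ps' //].
  - by rewrite size_cat; apply: sz.
have [ab'|[Pe [a1 b2]]|[Pe [a2 b1]]] := conn_cons ab.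
- have [s [ts ls Ps ss]] := IH _ _ ab'; exists s; split=> //; first exact: sub.
  by apply: leq_trans ss _; rewrite leq_exp2l.
- by apply: (two e.1.1 e.1.2) => //; apply: conn_edge.
- by apply: (two e.1.2 e.1.1) => //; apply: conn_sym; apply: conn_edge.
Qed.

Variable Rl : {set E} -> G -> G -> Prop.
Hypothesis Rrefl : forall d a, Rl d a a.
Hypothesis Rsym : forall d a b, Rl d a b -> Rl d b a.
Hypothesis Rtrans : forall d b a c, Rl d a b -> Rl d b c -> Rl d a c.
Hypothesis Rmono : forall d d' a b, d \subset d' -> Rl d a b -> Rl d' a b.
Hypothesis Rtot : forall a b, Rl setT a b.
Variables (a0 : G) (L : seq G).

Definition net Ed := [/\ forall e, e \in Ed -> Rl e.2 e.1.1 e.1.2,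
  forall x, x \in L -> conn any Ed a0 x &
  forall e, e \in Ed -> conn any Ed a0 e.1.1].

Definition weight Ed := \sum_(e <- Ed) 3 ^ #|e.2|.

Definition minimal Ed := net Ed /\ forall Ed', net Ed' -> weight Ed <= weight Ed'.

Definition w0 := size L * 3 ^ #|E|.

(** The star with centre [a0] and full labels is a net of weight [w0]. *)
Lemma minimal_exists : exists2 Ed, minimal Ed & weight Ed <= w0.
Proof.
pose star : seq ledge := [seq (a0, x, setT) | x <- L].
have nstar : net star.
  split.
  - by move=> _ /mapP[x _ ->]; apply: Rtot.
  - move=> x xL; have xs : (a0, x, setT) \in star by apply/mapP; exists x.
    exact: (conn_edge (P := any) xs).
  - by move=> _ /mapP[x _ ->]; apply: conn_refl.
have wstar : weight star = w0.
  rewrite /weight /star big_map /w0 (eq_bigr (fun=> 3 ^ #|E|)) => [|x _].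
    by rewrite big_const_seq count_predT iter_addn_0 mulnC.
  by rewrite cardsT.
have ex : exists n, `[< exists2 Ed, net Ed & weight Ed = n >].
  by exists w0; apply/asboolP; exists star.
case: (ex_minnP ex) => n /asboolP [Ed nEd wEd] nmin.
exists Ed; first split=> // Ed' nEd'.
  by rewrite wEd; apply: nmin; apply/asboolP; exists Ed'.
by rewrite -wstar wEd; apply: nmin; apply/asboolP; exists star.
Qed.

Lemma size_weight Ed : size Ed <= weight Ed.
Proof.
rewrite /weight -sum1_size; apply: leq_sum => e _; by rewrite expn_gt0.
Qed.

Lemma sub_conn_Rl Ed d a b : net Ed -> sub_conn Ed d a b -> Rl d a b.
Proof.
case=> RE _ _; elim=> [x|e eE ed|x y _|y x z _ xy _ yz].
- exact: Rrefl.
- by apply: Rmono ed _; apply: RE.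
- exact: Rsym.
- exact: Rtrans xy yz.
Qed.

Lemma weight_perm Ed Ed' : perm_eq Ed Ed' -> weight Ed = weight Ed'.
Proof. by move=> EE; apply: perm_big. Qed.

(** Otherwise [e] could be dropped. Only the later edges matter because [forest_lift] adds edges
    from the last to the first. *)
Lemma minimal_bridge Ed Ed1 e Ed2 : minimal Ed -> Ed = Ed1 ++ e :: Ed2 ->
  ~ conn any Ed2 e.1.1 e.1.2.
Proof.
move=> [[RE LE NE] mE] EE c; have : net (Ed1 ++ Ed2).
  have sub f : f \in Ed -> f = e \/ f \in Ed1 ++ Ed2.
    rewrite EE !mem_cat inE => /or3P[->|/eqP->|->]; rewrite ?orbT; by [right|left|right].
  have cn a b : conn any Ed a b -> conn any (Ed1 ++ Ed2) a b.
    apply: conn_subst => f /sub[-> _|fE _]; last exact: conn_edge.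
    by apply: conn_mono c => // g gE; rewrite mem_cat gE orbT.
  have sub' f : f \in Ed1 ++ Ed2 -> f \in Ed.
    by rewrite EE !mem_cat inE => /orP[->|->]; rewrite ?orbT.
  split=> [f /sub'/RE //|x /LE/cn //|f /sub'/NE/cn //].
move/mE; rewrite EE /weight !big_cat big_cons /= leqNgt => /negP; apply.
by rewrite ltn_add2l -[X in X < _]add0n ltn_add2r expn_gt0.
Qed.

(* Removing the long edges of [Ed] one at a time, some removal first separates
   [a] from [b]. *)
Lemma cut_edge (small : {set E} -> bool) Ed a b :
  conn any Ed a b -> ~ conn small Ed a b ->
  exists e Ed' Ed'', [/\ perm_eq Ed (e :: Ed' ++ Ed''), ~~ small e.2 &
    (conn any Ed' a e.1.1 /\ conn any Ed' e.1.2 b) \/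
    (conn any Ed' a e.1.2 /\ conn any Ed' e.1.1 b)].
Proof.
move=> + ns; have : perm_eq Ed (Ed ++ [::]) by rewrite cats0.
move: {2 3}Ed [::] => Ed0.
move: {2}(size Ed0) (leqnn (size Ed0)) => n; elim: n Ed0 => [|n IH] Ed0 sz Rem pE c.
  case: Ed0 sz pE c => // _ _ c; case: ns; apply: conn_subst c => //.
have [/hasP[e eE ne]|/hasPn nh] := boolP (has (fun e : ledge => ~~ small e.2) Ed0).
  have pe := perm_to_rem eE; set Ed1 := rem e Ed0 in pe.
  have pE' : perm_eq Ed (e :: Ed1 ++ Rem).
    by apply: perm_trans pE _; rewrite -cat_cons perm_cat2r.
  have c' : conn any (e :: Ed1) a b.
    by apply: conn_mono c => // f; rewrite (perm_mem pe).
  have sz' : size Ed1 <= n by rewrite size_rem // -ltnS prednK //; case: (Ed0) eE.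
  case: (conn_cons c') => [c1|[_ [c1 c2]]|[_ [c1 c2]]].
  - apply: (IH Ed1 sz' (e :: Rem)) => //; apply: perm_trans pE' _.
    by rewrite -cat1s perm_catCA.
  - by exists e, Ed1, Rem; split=> //; left.
  - by exists e, Ed1, Rem; split=> //; right.
case: ns; apply: conn_subst c => e eE _; apply: conn_edge.
  by rewrite (perm_mem pE) mem_cat eE.
by have := nh e eE; rewrite negbK.
Qed.

(** Otherwise a separating edge of at least [n] letters could be replaced by the two pieces through
    [m], whose weights are at most a third of its own each. *)
Lemma exchange Ed a m b d1 d2 n : minimal Ed ->
  conn any Ed a0 a -> conn any Ed a b -> Rl d1 a m -> Rl d2 m b ->
  #|d1| < n -> #|d2| < n -> conn (fun d => #|d| < n) Ed a b.
Proof.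
move=> [[RE LE NE] mE] ca cab r1 r2 s1 s2; apply: contrapT => ns.
have [e [Ed' [Ed'' [pE ne ends]]]] := cut_edge cab ns.
rewrite -leqNgt in ne.
pose N : seq ledge := (a, m, d1) :: (m, b, d2) :: Ed' ++ Ed''.
have inN f : f \in Ed' ++ Ed'' -> f \in N by rewrite !inE => ->; rewrite !orbT.
have am : conn any N a m.
  by apply: (@conn_edge any N (a, m, d1)) => //; rewrite inE eqxx.
have mb : conn any N m b.
  by apply: (@conn_edge any N (m, b, d2)) => //; rewrite !inE eqxx orbT.
have up x y : conn any Ed' x y -> conn any N x y.
  by apply: conn_mono => // f fE; apply: inN; rewrite mem_cat fE.
have ce : conn any N e.1.1 e.1.2.
  case: ends => -[/up c1 /up c2].
    apply: conn_trans (conn_sym c1) _; apply: conn_trans am _.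
    exact: conn_trans mb (conn_sym c2).
  apply: conn_trans c2 _; apply: conn_trans (conn_sym mb) _.
  exact: conn_trans (conn_sym am) c1.
have cn x y : conn any Ed x y -> conn any N x y.
  apply: conn_subst => f; rewrite (perm_mem pE) inE => /predU1P[-> //|fE] _.
  exact: conn_edge (inN _ fE) _.
have inE' f : f \in Ed' ++ Ed'' -> f \in Ed by rewrite (perm_mem pE) inE => ->; rewrite orbT.
have : net N.
  split=> [f|x /LE/cn //|f]; rewrite inE => /predU1P[-> //=|]; rewrite ?inE.
  - by move=> /predU1P[-> //|/inE'/RE].
  - exact: cn.
  - move=> /predU1P[-> /=|/inE'/NE/cn //]; exact: conn_trans (cn _ _ ca) am.
move/mE; rewrite (weight_perm pE) /weight !big_cons addnA leqNgt => /negP; apply.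
rewrite ltn_add2r; case: n s1 s2 ne {ns} => // n; rewrite !ltnS => s1 s2 ne.
apply: leq_trans (_ : 3 ^ n.+1 <= _); last by rewrite leq_exp2l.
apply: leq_ltn_trans (_ : 3 ^ n + 3 ^ n < _).
  by apply: leq_add; rewrite leq_exp2l.
by rewrite addnn -mul2n expnS ltn_pmul2r ?expn_gt0.
Qed.

(** Bounds the length of a cheapest trail in [minimal_realizes]: its cost is less than [M ^ #|E|.+1]
    with [M = 2 ^ size Ed], and [size Ed <= w0]. *)
Definition bound := (2 ^ w0) ^ #|E|.+1.

(* In a closed polygon of relations some side is cut at a new point into two
   pieces whose labels are contained in those of the neighbouring sides. *)
Hypothesis Rcyc : forall d a s, s != [::] -> size s <= bound -> trail Rl a s -> Rl d a (tail a s) ->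
  exists s1 d1 b s2 m, [/\ s = s1 ++ (d1, b) :: s2,
    Rl (last d (map fst s1) :&: d1) (tail a s1) m &
    Rl (d1 :&: head d (map fst s2)) m b].

(* Among the trails from [a] to [b] whose pieces are connected inside the network,
   take one that is cheapest for a base [M] exceeding the length of simple paths:
   a piece is then never worth any number of shorter ones. *)
Lemma minimal_realizes Ed d a b : minimal Ed -> weight Ed <= w0 ->
  conn any Ed a0 a -> conn any Ed a b -> Rl d a b -> sub_conn Ed d a b.
Proof.
move=> mE wE ca cab rab; have nE := mE.1.
pose M := 2 ^ size Ed.
have M0 : 0 < M by rewrite expn_gt0.
pose cost (s : seq ({set E} * G)) := \sum_(c <- s) M ^ #|c.1|.
have cost_cat s s' : cost (s ++ s') = cost s + cost s' by rewrite /cost big_cat.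
have cost_cons c s : cost (c :: s) = M ^ #|c.1| + cost s by rewrite /cost big_cons.
(* The ends are free up to [d]-connections, so that pieces can be absorbed into the closing side
   [d]. *)
pose good n := exists a' s, [/\ sub_conn Ed d a a', trail (sub_conn Ed) a' s,
  sub_conn Ed d (tail a' s) b & cost s = n].
have costP a' s : sub_conn Ed d a a' -> trail (sub_conn Ed) a' s ->
  sub_conn Ed d (tail a' s) b -> good (cost s) by exists a', s.
have cheap n P s : labels P s -> (forall c, P c -> #|c| <= n) -> size s < M ->
    cost s < M ^ n.+1.
  move=> Ps Pn ss; apply: leq_ltn_trans (_ : size s * M ^ n < _).
    rewrite /cost -sum1_size big_distrl /= big_seq [X in _ <= X]big_seq.
    by apply: leq_sum => c /Ps/Pn cn; rewrite mul1n leq_pexp2l.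
  by rewrite expnS ltn_pmul2r ?expn_gt0 ?M0.
have anyc x y d' : sub_conn Ed d' x y -> conn any Ed x y.
  by apply: conn_mono.
have [s0 [ts0 ls0 Ps0 ss0]] := conn_trail cab.
have g0 : good (cost s0) by apply: (costP a); rewrite ?ls0 //; apply: conn_refl.
have ex : exists n, `[< good n >] by exists (cost s0); apply/asboolP.
case: (ex_minnP ex) => n /asboolP [a' [s [aa ts tb cs]]] nmin.
have min s' a'' : sub_conn Ed d a a'' -> trail (sub_conn Ed) a'' s' ->
    sub_conn Ed d (tail a'' s') b -> cost s <= cost s'.
  by move=> H1 H2 H3; rewrite cs; apply: nmin; apply/asboolP/(costP a'').
have sb : size s <= bound.
  apply: leq_trans (_ : cost s <= _).
    by rewrite /cost -sum1_size; apply: leq_sum => c _; rewrite expn_gt0 M0.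
  rewrite cs; apply: leq_trans (nmin _ (asboolT g0)) _; apply: ltnW.
  apply: leq_trans (cheap #|E| any s0 Ps0 _ ss0) _; first by move=> c _; apply: max_card.
  by rewrite leq_exp2r // leq_exp2l //; apply: leq_trans (size_weight _) wE.
have [s0E|sn0] := eqVneq s [::].
  by move: tb; rewrite s0E /tail /=; apply: conn_trans aa.
have rt : Rl d a' (tail a' s).
  apply: Rtrans (Rsym (sub_conn_Rl nE aa)) _; apply: Rtrans rab _.
  exact/Rsym/(sub_conn_Rl nE).
have [|s1 [d1 [t [s2 [m [sE r1 r2]]]]]] := Rcyc sn0 sb _ rt.
  by apply: trail_mono ts => d' x y; apply: sub_conn_Rl.
have [t1 [/= c1 t2]] : trail (sub_conn Ed) a' s1 /\
    (sub_conn Ed d1 (tail a' s1) t /\ trail (sub_conn Ed) t s2).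
  by apply/(trail_cat _ a' s1 ((d1, t) :: s2)); rewrite -sE.
have tb' : sub_conn Ed d (tail t s2) b by move: tb; rewrite sE tail_cat.
have Mp k : 0 < M ^ k by rewrite expn_gt0 M0.
(* If the preceding label contained [d1], merging the piece into the preceding one, or into the
   closing side, would lower the cost. *)
have p1 : last d (map fst s1) :&: d1 \proper d1.
  rewrite properE subsetIr; apply/negP => /subsetIP[+ _].
  case: (lastP s1) sE t1 c1 {r1} => [|s1' [d' t']] sE t1 c1 /= dd.
    have := min s2 t; rewrite sE cost_cons leqNgt /= -[X in X < _]add0n ltn_add2r Mp.
    by move=> H; have := H (conn_trans aa (sub_connS dd c1)) t2 tb'.
  rewrite map_rcons last_rcons in dd.
  have := min (s1' ++ (d', t) :: s2) a' aa; rewrite sE -cats1 -catA /= !cost_cat !cost_cons /= !leq_add2l.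
  rewrite leqNgt -[X in X < _]add0n ltn_add2r Mp.
  move: t1; rewrite -cats1 => /trail_cat /= [t1 [c2 _]] H.
  suff: ~~ true by []; apply: H; last by rewrite tail_cat.
  apply/trail_cat; do !split=> //; apply: conn_trans c2 _.
  by move: c1; rewrite -cats1 tail_cat /=; apply: sub_connS.
have p2 : d1 :&: head d (map fst s2) \proper d1.
  rewrite properE subsetIl; apply/negP => /subsetIP[_].
  case: s2 sE t2 tb' {r2} => [|[d' t'] s2'] sE t2 tb' /= dd.
    have := min s1 a' aa t1; rewrite sE cost_cat cost_cons leqNgt.
    rewrite -[X in X < _]addn0 ltn_add2l addn_gt0 Mp => H.
    by have := H (conn_trans (sub_connS dd c1) tb').
  have := min (s1 ++ (d', t') :: s2') a' aa; rewrite sE !cost_cat !cost_cons /=.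
  rewrite leq_add2l leqNgt -[X in X < _]add0n ltn_add2r Mp => H.
  case: t2 => c2 t2.
  suff: ~~ true by []; apply: H; last by rewrite tail_cat.
  by apply/trail_cat; do !split=> //; apply: conn_trans (sub_connS dd c1) c2.
have ct1 : conn any Ed a0 (tail a' s1).
  apply: conn_trans ca _; apply: conn_trans (anyc _ _ _ aa) _.
  elim: (s1) (a') t1 => [|[d' x] s1' IH] y /=; first by move=> _; apply: conn_refl.
  by move=> [yx /IH]; apply: conn_trans; apply: anyc yx.
(* Both parts of the cut have fewer letters than [d1], so shorter edges join the ends of the piece;
   by the choice of [M] this detour is cheaper. *)
have := exchange mE ct1 (anyc _ _ _ c1) r1 r2 (proper_card p1) (proper_card p2).
case/conn_trail => s' [ts' ls' Ps' ss'].
have := min (s1 ++ s' ++ s2) a' aa; rewrite sE !cost_cat cost_cons /= leq_add2l leq_add2r.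
move: (proper_card p1); case Ek: #|d1| => [//|k] _.
rewrite leqNgt (cheap k _ _ Ps' _ ss'); last by move=> c; rewrite Ek ltnS.
move=> H; suff: ~~ true by []; apply: H.
  by apply/trail_cat; split=> //; apply/trail_cat; rewrite ls'.
by rewrite !tail_cat ls'.
Qed.

(* [F] covers [G]; [Fl_move] is the action of the deck transformations. *)
Section Lifting.
Variables (F : Type) (pr : F -> G) (Fl : {set E} -> F -> F -> Prop).
Hypothesis pr_surj : forall x, exists f, pr f = x.
Hypothesis Fl_lift : forall d a b f, Rl d a b -> pr f = a ->
  exists f', pr f' = b /\ Fl d f f'.
Hypothesis Fl_move : forall f f', pr f = pr f' -> exists t : F -> F,
  [/\ forall g, pr (t g) = pr g, forall d g h, Fl d g h -> Fl d (t g) (t h) & t f = f'].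

(** A new edge joins two components of the later ones. It is lifted from its first end, and a deck
    transformation moves the component of its second end into place. *)
Lemma forest_lift Ed : (forall e, e \in Ed -> Rl e.2 e.1.1 e.1.2) ->
  (forall Ed1 e Ed2, Ed = Ed1 ++ e :: Ed2 -> ~ conn any Ed2 e.1.1 e.1.2) ->
  exists f : G -> F, (forall x, pr (f x) = x) /\
    forall e, e \in Ed -> Fl e.2 (f e.1.1) (f e.1.2).
Proof.
elim: Ed => [|e Ed IH] RE br.
  have /choice [f fP] := pr_surj.
  by exists f.
have [|Ed1 e' Ed2 EE|f [prf fE]] := IH _ _.
- by move=> e' eE; apply: RE; rewrite inE eE orbT.
- by apply: (br (e :: Ed1)); rewrite EE.
have [f' [prf' ff']] := Fl_lift (RE e (mem_head _ _)) (prf e.1.1).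
have [t [prt tF tf]] : exists t : F -> F, [/\ forall g, pr (t g) = pr g,
    forall d g h, Fl d g h -> Fl d (t g) (t h) & t (f e.1.2) = f'].
  by apply: Fl_move; rewrite prf prf'.
pose moved x := `[< conn any Ed e.1.2 x >].
exists (fun x => if moved x then t (f x) else f x); split=> [x|e'].
  by case: ifP => _; rewrite ?prt prf.
rewrite inE => /predU1P[->|eE].
  have -> : moved e.1.1 = false.
    by apply/asboolP => /conn_sym; apply: (br [::]).
  have -> : moved e.1.2 by apply/asboolP/conn_refl.
  by rewrite tf.
have -> : moved e'.1.1 = moved e'.1.2.
  have c : conn any Ed e'.1.1 e'.1.2 by apply: conn_edge.
  apply/asboolP/asboolP => /conn_trans; apply=> //; exact: conn_sym.
by case: ifP => _; [apply: tF|]; apply: fE.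
Qed.

Hypothesis Fl_refl : forall d f, Fl d f f.
Hypothesis Fl_sym : forall d f g, Fl d f g -> Fl d g f.
Hypothesis Fl_trans : forall d g f h, Fl d f g -> Fl d g h -> Fl d f h.
Hypothesis Fl_mono : forall d d' f g, d \subset d' -> Fl d f g -> Fl d' f g.

Theorem lifting : exists f : G -> F, (forall x, pr (f x) = x) /\
  forall d a b, a \in L -> b \in L -> Rl d a b -> Fl d (f a) (f b).
Proof.
have [Ed mE wE] := minimal_exists.
have [[RE LE NE] _] := mE.
have [f [prf fE]] := forest_lift RE (fun Ed1 e Ed2 => minimal_bridge mE (Ed1 := Ed1)).
exists f; split=> // d a b aL bL rab.
have cab : conn any Ed a b by apply: conn_trans (conn_sym (LE a aL)) (LE b bL).
elim: (minimal_realizes mE wE (LE a aL) cab rab) => [x|e eE ed|x y _|y x z _ xy _ yz].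
- exact: Fl_refl.
- by apply: Fl_mono ed _; apply: fE.
- exact: Fl_sym.
- exact: Fl_trans xy yz.
Qed.

End Lifting.
End Networks.

(** * The graph of states *)

Section Relabel.
Variables (E : finType) (p : E -> E).
Hypothesis pinj : injective p.
Variable b : {set E} -> nat.
Hypothesis bp : forall d : {set E}, b (p @: d) = b d.

Section RelabelAct.
Variable S : eact E.
Lemma relabel_proper e (x y : S) : eeq x y -> eeq (estep (p e) x) (estep (p e) y).
Proof. exact: estep_proper. Qed.
Lemma relabelK e (x : S) : eeq (estep (p e) (estep (p e) x)) x.
Proof. exact: estepK. Qed.
Definition relabel :=
  EAct (@eeq_refl E S) (@eeq_sym E S) (@eeq_trans E S) relabel_proper relabelK.
Lemma relabel_run (x : S) w : erun (S := relabel) x w = erun x (map p w).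
Proof. by elim: w x => //= e w IH x; rewrite IH. Qed.
End RelabelAct.

Lemma over_map (d : {set E}) w : over (p @: d) (map p w) = over d w.
Proof. by rewrite /over all_map; apply: eq_all => e /=; rewrite mem_imset. Qed.

Lemma tr_map d w : tr b d w -> tr b (p @: d) (map p w).
Proof.
move: {2}(#|d|.+1) (ltnSn #|d|) => k; elim: k d w => // k IH d w dk tw.
apply/trP => S x cx kx; rewrite -relabel_run.
apply: (iffLR (trP _ _ _) tw (relabel S) x).
  case: cx => f cf; exists (fun i => f (cast_ord (esym (bp d)) i)) => u ou.
  rewrite relabel_run; have [|i xi] := cf (map p u); first by rewrite over_map.
  by exists (cast_ord (bp d) i); rewrite cast_ordK.
move=> d' w' dd' ow' tw' u ou; rewrite !relabel_run.
apply: (kx (p @: d')); rewrite ?over_map //.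
  by apply: imset_proper dd' => x1 x2 _ _; apply: pinj.
by apply: IH tw' => //; apply: leq_trans (proper_card dd') _.
Qed.

Lemma trT_map w : tr b setT w -> tr b setT (map p w).
Proof.
move=> /tr_map; have -> // : p @: setT = setT.
apply/eqP; rewrite eqEcard subsetT card_imset //=; exact: leqnn.
Qed.

Lemma eqw_map u w : eqw b u w -> eqw b (map p u) (map p w).
Proof. by move=> /trT_map; rewrite /eqw map_cat map_rev. Qed.

End Relabel.

Section Dilation.
Variable X : finType.
Implicit Types (f : pbij X) (x y : X).

Lemma pinvK f x : pbij_fun (pinv (pinv f)) x = pbij_fun f x.
Proof.
have E g u v : (pbij_fun (pinv g) u == Some v) = (pbij_fun g v == Some u).
  exact: pinv_funP.
case fx: (pbij_fun f x) => [y|]; first by apply/eqP; rewrite !E fx.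
case gx: (pbij_fun _ x) => [y|//].
by move/eqP: gx; rewrite !E fx.
Qed.

(* The unitary dilation of a partial bijection of [X] to a permutation of two
   copies of [X]. *)
Definition dilate f (z : X * bool) : X * bool :=
  if z.2 then
    if pbij_fun (pinv f) z.1 is Some x then (x, true) else (z.1, false)
  else if pbij_fun f z.1 is Some y then (y, false) else (z.1, true).

Lemma pinvE f x y : (pbij_fun (pinv f) y = Some x) <-> (pbij_fun f x = Some y).
Proof.
have E : (pbij_fun (pinv f) y == Some x) = (pbij_fun f x == Some y).
  exact: pinv_funP.
by split=> /eqP H; apply/eqP; rewrite E in H *.
Qed.

Lemma dilateK f : cancel (dilate f) (dilate (pinv f)).
Proof.
case=> x []; rewrite /dilate /=.
  case fx: (pbij_fun (pinv f) x) => [y|] /=; rewrite ?fx // pinvK.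
  by rewrite (iffLR (pinvE _ _ _) fx).
case fx: (pbij_fun f x) => [y|] /=; last by rewrite pinvK fx.
by rewrite (iffRL (pinvE _ _ _) fx).
Qed.

Definition dilation f : {perm X * bool} := perm (can_inj (dilateK f)).

End Dilation.

(** * The finite quotient G of the free group *)

Section Construction.
Variables (X : finType) (A : {set pbij X}).
Local Notation L := (label A).
Definition state : finType := ({perm X * bool} * bool)%type.
Definition alph : finType := (state * L)%type.
Implicit Types (s t v : state) (l : letter L) (w : seq (letter L)) (a : L).

(* The bit makes the graph of states free of loops. *)
Definition move l s : state :=
  ((s.1 * (if l.2 then (dilation (val l.1))^-1 else dilation (val l.1)))%g, ~~ s.2).

Lemma moveK l s : move (linv l) (move l s) = s.
Proof.
by case: s l => [s b] [a []]; rewrite /move /= negbK ?mulgK ?mulgKV.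
Qed.

(** Edges are undirected, so that they can serve as involutive letters. *)
Definition incid (e : alph) v : option state :=
  if v == e.1 then Some (move (e.2, false) e.1)
  else if v == move (e.2, false) e.1 then Some e.1 else None.

Lemma move_neq l s : (move l s == s) = false.
Proof. by apply/eqP => /(congr1 snd) /=; case: s.2. Qed.

Lemma incidK e v u : incid e v = Some u -> incid e u = Some v.
Proof.
rewrite /incid; case: eqP => [-> [<-]|_]; first by rewrite move_neq eqxx.
by case: eqP => // -> [<-]; rewrite eqxx.
Qed.

Definition elet l s : alph := if l.2 then (move l s, l.1) else (s, l.1).

Lemma incid_elet l s : incid (elet l s) s = Some (move l s).
Proof.
case: l => a []; rewrite /incid /elet /=; last by rewrite eqxx.
rewrite eq_sym move_neq; have E := moveK (a, true) s; rewrite /linv /= in E.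
by rewrite E eqxx.
Qed.

Lemma elet_inv l s : elet (linv l) (move l s) = elet l s.
Proof. by case: l => a [] //; rewrite /elet /= (moveK (a, false)). Qed.

Fixpoint pathw s w : seq alph := if w is l :: w' then elet l s :: pathw (move l s) w' else [::].
Definition endw s w : state := foldl (fun t l => move l t) s w.

Lemma pth_pathw s w : pth incid s (pathw s w) = Some (endw s w).
Proof. by elim: w s => //= l w IH s; rewrite incid_elet IH. Qed.

Lemma pathw_of s p v : pth incid s p = Some v -> exists2 w, pathw s w = p & endw s w = v.
Proof.
elim: p s => [|e p IH] s /=; first by case=> <-; exists [::].
case ie: (incid e s) => [u|//] /IH [w wp we].
suff [l le lu] : exists2 l, elet l s = e & move l s = u.
  by exists (l :: w) => /=; rewrite ?le lu ?wp ?we.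
move: ie; rewrite /incid; case: eqP => [-> [<-]|_].
  by exists (e.2, false) => //; rewrite /elet /=; case: (e).
case: eqP => // -> [<-]; exists (e.2, true); rewrite ?(moveK (e.2, false)) //.
by rewrite /elet /= (moveK (e.2, false)); case: (e).
Qed.

Lemma pathw_cat s w w' : pathw s (w ++ w') = pathw s w ++ pathw (endw s w) w'.
Proof. by elim: w s => //= l w IH s; rewrite IH. Qed.

Lemma endw_cat s w w' : endw s (w ++ w') = endw (endw s w) w'.
Proof. exact: foldl_cat. Qed.

Lemma winv_cons l w : winv (l :: w) = winv w ++ [:: linv l].
Proof. by rewrite /winv map_cons rev_cons cats1. Qed.

Lemma endw_inv s w : endw (endw s w) (winv w) = s.
Proof.
by elim: w s => //= l w IH s; rewrite winv_cons endw_cat IH /= moveK.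
Qed.

Lemma pathw_inv s w : pathw (endw s w) (winv w) = rev (pathw s w).
Proof.
elim: w s => //= l w IH s; rewrite winv_cons pathw_cat IH endw_inv /= elet_inv.
by rewrite rev_cons cats1.
Qed.

Definition shift s v : state := ((s.1 * v.1)%g, s.2 (+) v.2).
Definition shifte s (e : alph) : alph := (shift s e.1, e.2).

Lemma move_shift l s v : move l (shift s v) = shift s (move l v).
Proof. by rewrite /move /shift /= mulgA addbN. Qed.

Lemma shifte_inj s : injective (shifte s).
Proof. by move=> [u i] [v j] [] /mulgI H1 /addbI H2 ->; congr (_, _); case: u v H1 H2 => [? ?] [? ?] /= -> ->. Qed.

Lemma endw_shift s v w : endw (shift s v) w = shift s (endw v w).
Proof. by elim: w v => //= l w IH v; rewrite move_shift IH. Qed.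

Lemma pathw_shift s v w : pathw (shift s v) w = map (shifte s) (pathw v w).
Proof.
elim: w v => //= l w IH v; rewrite move_shift IH; congr (_ :: _).
by rewrite /elet move_shift; case: l.2.
Qed.

Lemma shift_to s t : exists u, shift u s = t.
Proof.
by exists ((t.1 * s.1^-1)%g, t.2 (+) s.2); rewrite /shift /= mulgKV addbK; case: (t).
Qed.

Variables (n : nat).

(** Admits the graph of states, and is at least 2 so that no single letter is a relator. *)
Definition base_bound := maxn #|state| 2.
(** The value of [bound] for a list of [n] points. *)
Definition chain_bound := (2 ^ (n * 3 ^ #|alph|)) ^ #|alph|.+1.
Local Notation bnd := (@bnd alph chain_bound base_bound).
Local Notation "u ~~ v" := (eqw bnd u v) (at level 70).

Lemma eqw_shift s p q : p ~~ q -> map (shifte s) p ~~ map (shifte s) q.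
Proof.
apply: eqw_map; first exact: shifte_inj.
by move=> d; apply: bnd_card; rewrite card_imset //; apply: shifte_inj.
Qed.

(* The graph of states has a group of symmetries that is transitive on states, so
   one state decides, see [same_at]. *)
Definition same w w' := forall s, endw s w = endw s w' /\ pathw s w ~~ pathw s w'.

Lemma same_at s w w' : endw s w = endw s w' -> pathw s w ~~ pathw s w' -> same w w'.
Proof.
move=> ew pw t; have [u <-] := shift_to s t.
by rewrite !endw_shift !pathw_shift ew; split=> //; apply: eqw_shift.
Qed.

Lemma same_refl w : same w w. Proof. by move=> s; split=> //; apply: eqw_refl. Qed.
Lemma same_sym w w' : same w w' -> same w' w.
Proof. by move=> H s; have [? ?] := H s; split=> //; apply: eqw_sym. Qed.
Lemma same_trans w w' w'' : same w w' -> same w' w'' -> same w w''.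
Proof.
move=> H H' s; have [-> p1] := H s; have [-> p2] := H' s; split=> //.
exact (eqw_trans p1 p2).
Qed.

Lemma same_cat w1 w1' w2 w2' : same w1 w1' -> same w2 w2' -> same (w1 ++ w2) (w1' ++ w2').
Proof.
move=> H1 H2 s; have [e1 p1] := H1 s; have [e2 p2] := H2 (endw s w1).
rewrite !endw_cat !pathw_cat -e1 e2; split=> //.
exact (eqw_cat p1 p2).
Qed.

Lemma same_inv w w' : same w w' -> same (winv w) (winv w').
Proof.
move=> H s; have [e1 p1] := H (endw s (winv w)).
have es : endw (endw s (winv w)) w = s by have := endw_inv s (winv w); rewrite winvK.
rewrite es in e1; have ew : endw s (winv w) = endw s (winv w').
  by rewrite {2}e1 endw_inv.
split=> //; have p2 := pathw_inv (endw s (winv w)) w; rewrite es in p2.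
by rewrite p2 {2}e1 pathw_inv; apply: eqw_rev.
Qed.

Lemma same_invr w : same (w ++ winv w) [::].
Proof.
move=> s; rewrite endw_cat pathw_cat endw_inv pathw_inv; split=> //.
exact: eqwVK.
Qed.

Lemma same_invl w : same (winv w ++ w) [::].
Proof. by have := same_invr (winv w); rewrite winvK. Qed.

Lemma same_push l w : same (push l w) (l :: w).
Proof.
case: w => [|m w] /=; first exact: same_refl.
case: eqP => [->|_]; last exact: same_refl.
rewrite -[l :: _ :: w]/([:: l; linv l] ++ w) -[w in same w _]/([::] ++ w).
by apply: same_cat (same_refl w); apply/same_sym/(same_invr [:: l]).
Qed.

Lemma same_wmul w w' : same (wmul w w') (w ++ w').
Proof.
elim: w => [|l w IH] /=; first exact: same_refl.
apply: same_trans (same_push l _) _.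
exact: (@same_cat [:: l] [:: l] _ _ (same_refl _) IH).
Qed.

Local Notation F := (freeG L).
Implicit Types f g : F.

Definition nsg_pre : {pred F} := fun f => `[< same (val f) [::] >].

Lemma nsg_preP f : reflect (same (val f) [::]) (f \in nsg_pre).
Proof. exact: asboolP. Qed.

Lemma val_mul f g : same (val (f * g)%g) (val f ++ val g).
Proof. exact: same_wmul. Qed.

Lemma nsg_pre_closed : group_closed nsg_pre.
Proof.
split; first by apply/nsg_preP; apply: same_refl.
move=> f g /nsg_preP fN /nsg_preP gN; apply/nsg_preP.
apply: same_trans (val_mul _ _) _; rewrite -[[::]]/([::] ++ winv [::]).
by apply: same_cat fN _; apply: same_inv.
Qed.

Lemma nsg_pre_conj f g : f \in nsg_pre -> (f ^ g)%g \in nsg_pre.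
Proof.
move=> /nsg_preP fN; apply/nsg_preP.
apply: same_trans (val_mul _ _) _.
apply: same_trans (same_cat (same_refl _) (val_mul _ _)) _.
apply: same_trans (same_cat (same_refl _) (same_cat fN (same_refl _))) _.
exact: same_invl.
Qed.

Definition kernel : normal_subgroup F := NormalSubgroup nsg_pre_closed nsg_pre_conj.
Local Notation G := (quotG kernel).
Implicit Types x y : G.

Lemma coset_same f g : coset kernel f = coset kernel g <-> same (val f) (val g).
Proof.
rewrite cosetP; split=> [/nsg_preP fg|fg].
  have fg' := same_trans (same_sym (val_mul _ _)) fg.
  apply: same_trans (same_trans (same_cat (same_refl _) (same_sym fg')) _).
    by rewrite cats0; apply: same_refl.
  by rewrite catA; apply: (same_cat (same_invr _) (same_refl _)).
apply/nsg_preP; apply: same_trans (val_mul _ _) _.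
apply: same_trans (same_cat (same_refl _) (same_sym fg)) _; exact: same_invl.
Qed.

Definition fw w : F := Sub (wmul w [::]) (wmul_reduced w (v := [::]) isT).

Lemma fw_val f : fw (val f) = f.
Proof. by apply/val_inj; rewrite /= wmulw0 // (valP f). Qed.

Lemma fw_same w : same (val (fw w)) w.
Proof. by have := same_wmul w [::]; rewrite cats0. Qed.

Lemma fw_cat w w' : fw (w ++ w') = (fw w * fw w')%g.
Proof.
apply/val_inj => /=; rewrite /wmul foldr_cat -/(wmul w' [::]).
have r := wmul_reduced w' (v := [::]) isT.
elim: w => //= l w IH; rewrite IH -wmul_push //; exact: wmul_reduced.
Qed.

Lemma fw_inv w : fw (winv w) = (fw w)^-1%g.
Proof.
elim: w => [|l w IH]; first by apply/val_inj.
have E : fw [:: linv l] = (fw [:: l])^-1%g by apply/val_inj.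
by rewrite winv_cons -[l :: w]cat1s !fw_cat IH E invgM.
Qed.

Definition s0 : state := (1%g, false).

Definition st x : state := endw s0 (val (generic_quotient.repr x)).

Lemma st_coset f : st (coset kernel f) = endw s0 (val f).
Proof.
have /coset_same H : coset kernel (generic_quotient.repr (coset kernel f)) = coset kernel f.
  by rewrite /coset reprK.
by rewrite /st; have [-> _] := H s0.
Qed.

Definition wc w : G := coset kernel (fw w).

Lemma wc_cat w w' : wc (w ++ w') = (wc w * wc w')%g.
Proof. by rewrite /wc fw_cat cosetM. Qed.

Lemma wc_inv w : wc (winv w) = (wc w)^-1%g.
Proof. by rewrite /wc fw_inv cosetV. Qed.

Lemma wc_same w w' : wc w = wc w' <-> same w w'.
Proof.
rewrite /wc coset_same; split=> H.
  exact: same_trans (same_sym (fw_same w)) (same_trans H (fw_same w')).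
exact: same_trans (fw_same w) (same_trans H (same_sym (fw_same w'))).
Qed.

Lemma st_mul x w : st (x * wc w)%g = endw (st x) w.
Proof.
have [f ->] := coset_surj x; rewrite -cosetM !st_coset.
have [-> _] := val_mul f (fw w) s0; rewrite endw_cat.
by have [-> _] := fw_same w (endw s0 (val f)).
Qed.

Lemma wc_surj x : exists w, x = wc w.
Proof. by have [f ->] := coset_surj x; exists (val f); rewrite /wc fw_val. Qed.

Implicit Type d : {set alph}.

Definition Rl d x y := exists w, (x * wc w)%g = y /\ over d (pathw (st x) w).

Definition Fl d f g := exists w, (f * fw w)%g = g /\ over d (pathw (endw s0 (val f)) w).

Lemma Rl_refl d x : Rl d x x.
Proof. by exists [::]; rewrite /wc (_ : fw [::] = 1%g) ?mulg1 //; apply/val_inj. Qed.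

Lemma Rl_sym d x y : Rl d x y -> Rl d y x.
Proof.
case=> w [<- ow]; exists (winv w); rewrite wc_inv mulgK; split=> //.
by rewrite st_mul pathw_inv over_rev.
Qed.

Lemma Rl_trans d y x z : Rl d x y -> Rl d y z -> Rl d x z.
Proof.
case=> w [<- ow] [w' [<- ow']]; exists (w ++ w'); rewrite wc_cat mulgA; split=> //.
by rewrite pathw_cat over_cat ow -st_mul.
Qed.

Lemma Rl_mono d d' x y : d \subset d' -> Rl d x y -> Rl d' x y.
Proof. by move=> dd [w [<- ow]]; exists w; split=> //; apply: over_sub ow. Qed.

Lemma Rl_tot x y : Rl setT x y.
Proof.
have [w E] := wc_surj (x^-1 * y)%g; exists w; rewrite -E mulKVg; split=> //.
exact: overT.
Qed.

Lemma Fl_refl d f : Fl d f f.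
Proof. by exists [::]; rewrite (_ : fw [::] = 1%g) ?mulg1 //; apply/val_inj. Qed.

Lemma endw_mul f w : endw s0 (val (f * fw w)%g) = endw (endw s0 (val f)) w.
Proof. by rewrite -st_coset cosetM st_mul st_coset. Qed.

Lemma Fl_sym d f g : Fl d f g -> Fl d g f.
Proof.
case=> w [<- ow]; exists (winv w); rewrite fw_inv mulgK; split=> //.
by rewrite endw_mul pathw_inv over_rev.
Qed.

Lemma Fl_trans d g f h : Fl d f g -> Fl d g h -> Fl d f h.
Proof.
case=> w [<- ow] [w' [<- ow']]; exists (w ++ w'); rewrite fw_cat mulgA; split=> //.
by rewrite pathw_cat over_cat ow -endw_mul.
Qed.

Lemma Fl_mono d d' f g : d \subset d' -> Fl d f g -> Fl d' f g.
Proof. by move=> dd [w [<- ow]]; exists w; split=> //; apply: over_sub ow. Qed.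

Lemma Fl_lift d x y f : Rl d x y -> coset kernel f = x ->
  exists f', coset kernel f' = y /\ Fl d f f'.
Proof.
case=> w [<- ow] fx; exists (f * fw w)%g; rewrite cosetM fx; split=> //.
by exists w; split=> //; rewrite -st_coset fx.
Qed.

Lemma Fl_move f f' : coset kernel f = coset kernel f' -> exists t : F -> F,
  [/\ forall g, coset kernel (t g) = coset kernel g,
      forall d g h, Fl d g h -> Fl d (t g) (t h) & t f = f'].
Proof.
move=> ff; exists (fun g => f' * f^-1 * g)%g.
have cg g : coset kernel (f' * f^-1 * g)%g = coset kernel g.
  by rewrite !cosetM cosetV ff mulgV mul1g.
split=> // [d g h [w [<- ow]]|]; last by rewrite mulgKV.
by exists w; rewrite !mulgA; split=> //; rewrite -st_coset cg st_coset.
Qed.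

Lemma base_gt1 : 1 < base_bound. Proof. exact: leq_maxr. Qed.
Lemma base_state : #|state| <= base_bound. Proof. exact: leq_maxl. Qed.

(** By [path_split] the two factors may be taken as paths of the graph of states, which are read off
    from words in the generators. *)
Lemma Rl_split d1 d2 x w : splits chain_bound base_bound d1 d2 (pathw (st x) w) ->
  exists m, Rl d1 x m /\ Rl d2 m (x * wc w)%g.
Proof.
case=> p [q [op oq pq]].
have pos : 0 < chain_bound by rewrite !expn_gt0.
have [a [b [oa ob pab ab]]] :=
  path_split base_gt1 incidK base_state pos (pth_pathw (st x) w) op oq pq.
have [u up ue] := pathw_of pab.
move: pab; rewrite pth_cat; case pa: (pth _ _ a) => [v|//] pb.
have [wa wap wae] := pathw_of pa; have [wb wbp wbe] := pathw_of pb.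
exists (x * wc wa)%g; split; first by exists wa; rewrite wap.
exists wb; rewrite st_mul wae wbp; split=> //.
rewrite -mulgA -wc_cat; congr (_ * _)%g; apply/wc_same/(same_at (s := st x)).
  by rewrite endw_cat wae wbe.
rewrite pathw_cat wap wae wbp; exact: eqw_sym.
Qed.

Local Notation link := (({set alph} * seq alph) * G)%type.
Definition step_of (z : link) := (z.1.1, z.2).

Fixpoint traced x (u : seq link) : Prop :=
  if u is (d, c, y) :: u' then
    (exists w, [/\ (x * wc w)%g = y, pathw (st x) w = c & over d c]) /\ traced y u'
  else True.

Lemma traced_trail x (s : seq ({set alph} * G)) : trail Rl x s -> exists2 u, s = map step_of u & traced x u.
Proof.
elim: s x => [|[d y] s IH] x /=; first by exists [::].
case=> [[w [wE ow]] /IH [u -> tu]].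
by exists ((d, pathw (st x) w, y) :: u) => //; split=> //; exists w.
Qed.

Lemma traced_word x u : traced x u -> exists w,
  (x * wc w)%g = tail x (map step_of u) /\ pathw (st x) w = chain_word (map fst u).
Proof.
elim: u x => [|[[d c] y] u IH] x /=.
  by exists [::]; rewrite /wc (_ : fw [::] = 1%g) ?mulg1 //; apply/val_inj.
case=> [[w [wE wp _]] /IH [w' [w'E w'p]]]; exists (w ++ w').
rewrite wc_cat mulgA wE w'E pathw_cat -st_mul wE w'p wp; split=> //.
Qed.

Lemma traced_over x u : traced x u -> chain_over (map fst u).
Proof. by elim: u x => //= -[[d c] y] u IH x [[w [_ _ ->]] /IH]. Qed.

Lemma traced_at x u1 z u2 : traced x (u1 ++ z :: u2) -> exists w,
  (tail x (map step_of u1) * wc w)%g = z.2 /\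
  pathw (st (tail x (map step_of u1))) w = z.1.2.
Proof.
elim: u1 x => [|[[d c] y] u1 IH] x /=; last by case=> _ /IH.
by case: z => [[d c] y] /= [[w [? ? _]] _]; exists w.
Qed.

Lemma not_chain_ok d b (u : seq link) : ~ chain_ok chain_bound base_bound b (map fst u) ->
  exists u1 z u2, u = u1 ++ z :: u2 /\
    splits chain_bound base_bound (last b (map fst (map fst u1)) :&: z.1.1)
      (z.1.1 :&: head d (map fst (map fst u2))) z.1.2.
Proof.
elim: u b => [|[[b1 c1] y1] [|[[b2 c2] y2] u] IH] b nok; try by case: nok.
have [sp|nsp] := pselect (splits chain_bound base_bound (b :&: b1) (b1 :&: b2) c1).
  by exists [::], (b1, c1, y1), ((b2, c2, y2) :: u).
have [|u1 [z [u2 [-> sp]]]] := IH b1.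
  by move=> ok; apply: nok.
by exists ((b1, c1, y1) :: u1), z, u2.
Qed.

(** Either a side other than the first and the last is degenerate, or [word_cycle] cuts the
    first. *)
Lemma Rl_cycle d x (s : seq ({set alph} * G)) : s != [::] -> size s <= chain_bound -> trail Rl x s ->
  Rl d x (tail x s) ->
  exists q1 d1 y q2 m, [/\ s = q1 ++ (d1, y) :: q2,
    Rl (last d (map fst q1) :&: d1) (tail x q1) m &
    Rl (d1 :&: head d (map fst q2)) m y].
Proof.
move=> sn sz /traced_trail [u sE tu]; rewrite {}sE in sn sz * => -[w [wE ow]].
have lab (q : seq link) : map fst (map step_of q) = map fst (map fst q) by rewrite -!map_comp.
suff [u1 [z [u2 [uE sp]]]] : exists u1 z u2, u = u1 ++ z :: u2 /\
    splits chain_bound base_bound (last d (map fst (map fst u1)) :&: z.1.1)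
      (z.1.1 :&: head d (map fst (map fst u2))) z.1.2.
  rewrite uE in tu; have [w1 [w1E w1p]] := traced_at tu.
  rewrite -w1p in sp; have [m [r1 r2]] := Rl_split sp.
  exists (map step_of u1), z.1.1, z.2, (map step_of u2), m.
  by rewrite w1E in r2; rewrite uE map_cat !lab; split.
have [w' [w'E w'p]] := traced_word tu.
have ww : pathw (st x) w ~~ chain_word (map fst u).
  have /wc_same H : wc w = wc w' by apply: (mulgI x); rewrite wE w'E.
  by have [_] := H (st x); rewrite w'p.
case: u sn sz tu ww {wE w'E w'p} => [//|[[b1 c1] y1] u] _ sz tu ww.
have [ok|nok] := pselect (chain_ok chain_bound base_bound b1 (map fst u)).
  exists [::], (b1, c1, y1), u; split=> //=.
  have sz' : size (map fst u) <= chain_bound.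
    by rewrite size_map; move: sz; rewrite size_map; apply: ltnW.
  have := word_cycle base_gt1 ow (traced_over tu) ok sz' ww.
  by case: (u) => [|[[]]].
have [u1 [z [u2 [-> sp]]]] := not_chain_ok d nok.
by exists ((b1, c1, y1) :: u1), z, u2.
Qed.

Lemma lift_points (h : 'I_n -> G) : exists phi : G -> F,
  (forall x, coset kernel (phi x) = x) /\
  forall d i j, Rl d (h i) (h j) -> Fl d (phi (h i)) (phi (h j)).
Proof.
have cyc d x (s : seq ({set alph} * G)) : s != [::] -> size s <= bound alph (codom h) -> trail Rl x s ->
  Rl d x (tail x s) ->
  exists q1 d1 y q2 m, [/\ s = q1 ++ (d1, y) :: q2,
    Rl (last d (map fst q1) :&: d1) (tail x q1) m &
    Rl (d1 :&: head d (map fst q2)) m y].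
  by rewrite /bound /w0 size_codom card_ord; apply: Rl_cycle.
have surj x : exists f, coset kernel f = x by have [f ->] := coset_surj x; exists f.
have [phi [phiP phiR]] := lifting Rl_refl Rl_sym Rl_trans Rl_mono Rl_tot 1%g cyc surj
  Fl_lift Fl_move Fl_refl Fl_sym Fl_trans Fl_mono.
by exists phi; split=> // d i j; apply: phiR; apply: codom_f.
Qed.

(** For the finiteness of G: end state and code determine a coset. *)
Definition class_key x : state * codeT alph (bnd setT) :=
  (st x, code (bnd setT) (pathw s0 (val (generic_quotient.repr x)))).

Lemma class_key_inj : injective class_key.
Proof.
move=> x y [sxy cxy]; rewrite -[x]reprK -[y]reprK.
apply/coset_same/(same_at (s := s0)) => //.
exact (code_tr (leqnn _) (overT _) (overT _) cxy).
Qed.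

End Construction.

(** * Classes of X_P G as paths *)

Section ThetaPaths.
Variables (X : finType) (A : {set pbij X}).
Local Notation L := (label A).
Implicit Types (l : letter L) (w : seq (letter L)) (x y : X).

Lemma pact_linv x l y : pact x l = Some y -> pact y (linv l) = Some x.
Proof.
by rewrite /pact; case: l => a [] /= /pinvE //; rewrite pinvK.
Qed.

Fixpoint prun x w : option X :=
  if w is l :: w' then if pact x l is Some y then prun y w' else None else Some x.

Lemma prun_cat x w w' :
  prun x (w ++ w') = if prun x w is Some y then prun y w' else None.
Proof. by elim: w x => //= l w IH x; case: (pact x l). Qed.

Lemma prun_inv x w y : prun x w = Some y -> prun y (winv w) = Some x.
Proof.
elim: w x => [|l w IH] x /=; first by case=> ->.
case xl: (pact x l) => [z|//] /IH H.
by rewrite winv_cons prun_cat H /= (pact_linv xl).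
Qed.

Section Group.
Variable G : agroup L.

Definition ev w : G := foldr (fun l g => lval G l * g)%g 1%g w.

Lemma ev_cat w w' : ev (w ++ w') = (ev w * ev w')%g.
Proof. by elim: w => [|l w IH] /=; rewrite ?mul1g // IH mulgA. Qed.

Lemma ev_inv w : ev (winv w) = (ev w)^-1%g.
Proof.
elim: w => [|l w IH] /=; first by rewrite invg1.
rewrite winv_cons ev_cat IH invgM /= mulg1; congr (_ * _)%g.
by case: l => a [] //; rewrite /lval /= invgK.
Qed.

(** With [prun_Theta] this describes [Theta] by words that run from one point to the other. *)
Lemma Theta_prun p q : Theta (G := G) p q ->
  exists2 w, prun p.1 w = Some q.1 & p.2 = (ev w * q.2)%g.
Proof.
elim=> {p q} [l x1 x2 /eqP e|l p q _ [w pw wE]|p|p q _ [w pw wE]|p q r _ [w pw wE] _ [w' pw' wE']].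
- by exists [:: l] => /=; rewrite ?e // !mulg1.
- by exists w => //=; rewrite wE mulgA.
- by exists [::] => //; rewrite mul1g.
- by exists (winv w); [apply: prun_inv|rewrite ev_inv wE mulKg].
- by exists (w ++ w'); rewrite ?prun_cat ?pw // wE wE' ev_cat mulgA.
Qed.

Lemma Theta_ev p q w : Theta (G := G) p q ->
  Theta (G := G) (p.1, p.2 * ev w)%g (q.1, q.2 * ev w)%g.
Proof.
elim: w p q => [|l w IH] p q pq /=; first by rewrite !mulg1; case: (p) (q) pq => ? ? [].
by rewrite !mulgA; apply: (IH (p.1, p.2 * _)%g (q.1, q.2 * _)%g); apply: Theta_op.
Qed.

Lemma prun_Theta x y w v : prun x w = Some y ->
  Theta (G := G) (x, ev w * ev v)%g (y, ev v).
Proof.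
elim: w x => [|l w IH] x /=; first by case=> ->; rewrite mul1g; apply: Theta_refl.
case xl: (pact x l) => [z|//] /IH; apply: Theta_trans.
have e : edge l x z by apply/eqP.
have := Theta_ev (w ++ v) (Theta_edge G e).
by rewrite ev_cat /= mul1g mulgA.
Qed.

End Group.

Lemma ev_fw w : ev (freeG L) w = fw w.
Proof.
elim: w => [|l w IH] /=; first exact/val_inj.
rewrite IH -[l :: w]cat1s fw_cat; congr (_ * _)%g.
by case: l => a []; apply/val_inj.
Qed.

Lemma ev_wc n w : ev (quotG (kernel A n)) w = wc n w.
Proof.
elim: w => [|l w IH] /=; first by rewrite /wc (_ : fw [::] = 1%g) //; apply/val_inj.
rewrite IH -[l :: w]cat1s wc_cat; congr (_ * _)%g.
have -> : wc n [:: l] = coset (kernel A n) (lval (freeG L) l).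
  by congr coset; case: l => a []; apply/val_inj.
by case: l => a [] //; rewrite /lval /= cosetV.
Qed.

(* The edges of the graph of states along which the point that [z] denotes
   stays in the domain of the partial bijections. *)
Definition alive (z : X * bool) : {set alph A} :=
  [set e : alph A | ~~ (e.1.1 z).2 && (pbij_fun (val e.2) (e.1.1 z).1 != None)].

Section Alive.
Variable z : X * bool.
Implicit Type s : state X.

(** On the copy [false] the dilation agrees with the partial bijection where that is defined and
    leaves the copy elsewhere. *)
Lemma alive_step s l x : s.1 z = (x, false) ->
  (elet l s \in alive z) = (pact x l != None) /\
  forall y, pact x l = Some y -> (move l s).1 z = (y, false).
Proof.
move=> sz; case: l => a []; rewrite inE /elet /move /pact /=; last first.
  split=> [|y ay]; first by rewrite sz.
  by rewrite permM sz permE /dilate /= ay.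
set t := ((dilation (val a))^-1)%g; rewrite permM sz.
have tE : dilate (val a) (t (x, false)) = (x, false).
  by have := permKV (dilation (val a)) (x, false); rewrite permE.
have back y : pbij_fun (pinv (val a)) x = Some y -> t (x, false) = (y, false).
  move=> /pinvE ay; apply: (can_inj (dilateK (val a))); rewrite tE.
  by rewrite /dilate /= ay.
split=> [|y /back //].
case ax: (pbij_fun (pinv (val a)) x) => [y|].
  by rewrite (back _ ax) /= ((pinvE _ _ _).1 ax).
case Et: (t (x, false)) tE => [y []] //= .
by rewrite /dilate /=; case ay: (pbij_fun _ y) => [u|] // [ux]; move/pinvE: ay; rewrite ux ax.
Qed.

Lemma alive_prun s w x : s.1 z = (x, false) ->
  over (alive z) (pathw s w) = (prun x w != None) /\
  forall y, prun x w = Some y -> (endw s w).1 z = (y, false).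
Proof.
elim: w s x => [|l w IH] s x sz /=; first by split=> // y [<-].
have [-> H] := alive_step l sz; case xl: (pact x l) => [u|//] /=.
exact: IH (H _ xl).
Qed.

End Alive.

(** If two classes agree, a word [w] runs from [x] to [y] and takes [(g i)^-1] to [(g j)^-1] on the
    right; hence the inverses. With [z] sent to [x] by the state of [(g i)^-1], running from [x]
    means staying over [alive z], which lifts. *)
Theorem lift_classes n (g : 'I_n -> quotG (kernel A n)) : exists f : 'I_n -> freeG L,
  (forall i, g i = coset (kernel A n) (f i)) /\
  forall i j x y, xcls x (g i) = xcls y (g j) -> xcls x (f i) = xcls y (f j).
Proof.
have [phi [phiP phiR]] := lift_points (fun i => (g i)^-1%g).
exists (fun i => (phi (g i)^-1%g)^-1%g); split=> [i|i j x y].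
  by rewrite cosetV phiP invgK.
move/xclsP/Theta_prun => [w /= xw wE].
have st0 k : st (g k)^-1%g = endw (s0 X) (val (phi (g k)^-1%g)).
  by rewrite -(st_coset n) phiP.
pose s := st (g i)^-1%g; pose z := (s.1^-1)%g (x, false).
have sz : s.1 z = (x, false) by rewrite permKV.
have hw : ((g i)^-1 * wc n w)%g = (g j)^-1%g.
  by rewrite -ev_wc wE invgM mulgKV.
have [ow we] := alive_prun w sz.
have [w' [w'E ow']] : Fl (alive z) (phi (g i)^-1%g) (phi (g j)^-1%g).
  by apply: phiR; exists w; rewrite ow xw.
rewrite -st0 in ow'; have [o'w' w'e] := alive_prun w' sz.
move: ow'; rewrite o'w'; case xw': (prun x w') => [y'|//] _.
have sj : endw s w = endw s w'.
  have -> : endw s w = st (g j)^-1%g by rewrite -hw st_mul.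
  rewrite /s (st0 i) (st0 j) -w'E; exact: endw_mul.
(* Both words end in the same state, so the lifted one also runs to [y]. *)
have [yy] : (y, false) = (y', false) by rewrite -(we _ xw) -(w'e _ xw') sj.
have := prun_Theta (freeG L) (val (phi (g j)^-1%g)^-1%g) xw'.
rewrite !ev_fw !fw_val -yy => T; apply/xclsP; move: T.
by rewrite -w'E invgM mulgA mulgV mul1g.
Qed.

End ThetaPaths.

(* The theorem *)
From mathcomp Require Import classical_sets cardinality.

Theorem proposition4p19 (X : finType) (A : {set pbij X}) (n : nat)
    (hn : (0 < n)%N) :
  exists N : normal_subgroup (freeG (label A)),
    finite_set [set: quotG N]%classic /\
    forall g : 'I_n -> quotG N, exists f : 'I_n -> freeG (label A),
      (forall i, g i = coset N (f i)) /\
      partial_function (pairs g f) /\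
      partial_bijection (pairs g f) /\
      induced_by (converse (pairs g f)) (can_map N).
Proof.
exists (kernel A n); split.
  have cinj : {in (@class_key X A n @^-1` setT)%classic &, injective (@class_key X A n)}.
    by move=> x y _ _; apply: class_key_inj.
  by have := finite_preimage cinj finite_finset; rewrite preimage_setT.
move=> g; have [f [gf key]] := lift_classes g; exists f.
have pf : partial_function (pairs g f).
  move=> _ _ v' [x _ [i _ [<- <-]]] [y _ [j _ [yj <-]]].
  by apply: key.
have ind : induced_by (converse (pairs g f)) (can_map (kernel A n)).
  by move=> _ _ [x _ [i _ [<- <-]]]; rewrite can_mapE gf.
split; first exact: gf; split; first exact: pf.
(* The converse is a function as a restriction of [can_map]. *)
split=> //; split=> // v u u' uv uv'.
by rewrite -(ind _ _ uv) -(ind _ _ uv').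
Qed.
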